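(* Let $T$ be a second countable locally compact Hausdorff space, let $\sigma:\mathrm{dom}(\sigma)\to\mathrm{ran}(\sigma)$ be a partial local homeomorphism on $T$, and let $p:\mathbf{B}\to\mathrm{dom}(\sigma)$ be a (second countable) principal circle bundle. Denote by $j:\mathrm{dom}(\sigma)\to\Gamma(T,\sigma)$ the embedding such that $j(t)=(t,1,\sigma(t))$. Then there exists a topological twist \[ \mathbb{T}\times\Gamma^0\xrightarrow{\ i\ }\Lambda\xrightarrow{\ p'\ }\Gamma(T,\sigma) \] over the Renault-Deaconu groupoid $\Gamma(T,\sigma)$ such that the pullback bundle $j^*(\Lambda)$ of $\Lambda$ by $j$ is isomorphic to $\mathbf{B}$ (as a principal circle bundle over $\mathrm{dom}(\sigma)$).
   Context: All topological spaces are assumed second countable and all locally compact groupoids are second countable locally compact Hausdorff. A principal circle bundle over a locally compact Hausdorff space is a locally trivial principal $\mathbb{T}$-bundle. A partial local homeomorphism on a locally compact Hausdorff space $T$ is a local homeomorphism $\sigma:\mathrm{dom}(\sigma)\to\mathrm{ran}(\sigma)$ where $\mathrm{dom}(\sigma),\mathrm{ran}(\sigma)$ are open subsets of $T$. Renault-Deaconu groupoid. $\Gamma(T,\sigma):=\{(t_1,k_1-k_2,t_2)\in T\times\mathbb{Z}\times T: k_1,k_2\ge0,\ t_1\in\mathrm{dom}(\sigma^{k_1}),\ t_2\in\mathrm{dom}(\sigma^{k_2}),\ \sigma^{k_1}(t_1)=\sigma^{k_2}(t_2)\}$ with $(t_1,n,t_2)(t_2,m,t_3)=(t_1,n+m,t_3)$,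 $(t_1,n,t_2)^{-1}=(t_2,-n,t_1)$, $r(t_1,n,t_2)=(t_1,0,t_1)$, $s(t_1,n,t_2)=(t_2,0,t_2)$, unit space $\Gamma^0=\{(t,0,t):t\in T\}$, and topology generated by the sets $\{(t_1,k_1-k_2,t_2): t_1\in U,t_2\in V,\sigma^{k_1}(t_1)=\sigma^{k_2}(t_2)\}$ with $U\subset\mathrm{dom}(\sigma^{k_1})$, $V\subset\mathrm{dom}(\sigma^{k_2})$ open in $T$, $\sigma^{k_1}$ injective on $U$ and $\sigma^{k_2}$ injective on $V$. It is an étale groupoid (its range map is a local homeomorphism). Topological twists. Let $\Gamma$ be an étale groupoid and $\Lambda$ a locally compact groupoid with common unit space $\Gamma^0$. $\Lambda$ is a topological twist over $\Gamma$ if there is a sequence of groupoid homomorphisms $\mathbb{T}\times\Gamma^0\xrightarrow{i}\Lambda\xrightarrow{p}\Gamma$ such that (1) $i$ is a homeomorphism onto $p^{-1}(\Gamma^0)$; (2) $p$ is a continuous open surjection and admits continuous local sections; (3) $\lambda\, i(z,s(\lambda))\lambda^{-1}=i(z,r(\lambda))$ for all $z\in\mathbb{T}$, $\lambda\in\Lambda$. With the circle action $z\cdot\lambda:=i(z,r(\lambda))\lambda$, $p:\Lambda\to\Gamma$ is a principal circle bundle. *)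

(* Defs.v *)
From HB Require Import structures.
From mathcomp Require Import all_boot all_order all_algebra.
From mathcomp Require Import zify.
From mathcomp Require Export complex.
From mathcomp Require Export all_classical all_reals topology.

Set Implicit Arguments.
Unset Strict Implicit.
Unset Printing Implicit Defensive.

Import GRing.Theory Num.Theory.

Local Open Scope classical_set_scope.
Local Open Scope ring_scope.
Local Open Scope complex_scope.

Section Homeomorphisms.
Variables X Y : topologicalType.

Definition open_map (f : X -> Y) : Prop :=
  forall A : set X, open A -> open (f @` A).

(* [f] is a homeomorphism of [X] onto the subspace [B] of [Y]; the last clause
   says that [f] is open as a map into [B] with the subspace topology. *)
Definition homeomorphism_onto (f : X -> Y) (B : set Y) : Prop :=
  [/\ continuous f, injective f, range f = B &
      forall A : set X, open A -> exists2 V : set Y, open V & f @` A = V `&` B].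

End Homeomorphisms.

Definition local_homeomorphism (X Y : topologicalType) (f : X -> Y) : Prop :=
  forall x : X, exists U : set X,
    [/\ open U, U x, open (f @` U) &
        homeomorphism_onto (fun u : set_type U => f (set_val u)) (f @` U)].

(* [R[i]^o] is [R[i]] with the topology given by its norm. *)
Definition unit_circle (R : realType) : set R[i]^o := [set z : R[i] | `|z| = 1].
Arguments unit_circle R : clear implicits.

Definition circle (R : realType) : Type := set_type (unit_circle R).

Section CircleGroup.
Variable R : realType.
Implicit Types z w : circle R.

Lemma circle_norm z : `|set_val z| = 1.
Proof. by have := set_valP z. Qed.

Fact circle_one_subproof : (1 : R[i]^o) \in unit_circle R.
Proof. by apply: mem_set; rewrite /unit_circle /= normr1. Qed.

Definition circle_one : circle R :=
  exist (fun c => c \in unit_circle R) _ circle_one_subproof.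

Fact circle_mul_subproof z w :
  (set_val z * set_val w : R[i]^o) \in unit_circle R.
Proof.
by apply: mem_set; rewrite /unit_circle /= normrM !circle_norm mulr1.
Qed.

Definition circle_mul z w : circle R :=
  exist (fun c => c \in unit_circle R) _ (circle_mul_subproof z w).

Fact circle_inv_subproof z : ((set_val z)^-1 : R[i]^o) \in unit_circle R.
Proof. by apply: mem_set; rewrite /unit_circle /= normfV circle_norm invr1. Qed.

Definition circle_inv z : circle R :=
  exist (fun c => c \in unit_circle R) _ (circle_inv_subproof z).

Lemma circle_mulA : associative circle_mul.
Proof. by move=> x y z; apply: val_inj; rewrite /= mulrA. Qed.

Lemma circle_mul1 : left_id circle_one circle_mul.
Proof. by move=> x; apply: val_inj; rewrite /= mul1r. Qed.

Lemma circle_mulC : commutative circle_mul.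
Proof. by move=> x y; apply: val_inj; rewrite /= mulrC. Qed.

Lemma circle_mulV z : circle_mul z (circle_inv z) = circle_one.
Proof.
apply: val_inj; rewrite /= mulfV // -normr_eq0 circle_norm.
exact: oner_neq0.
Qed.

End CircleGroup.

(* Raw data only: [cact] need not be an action, nor [bproj] continuous; see
   [principal_circle_bundle]. *)
Record circle_space (R : realType) (X : topologicalType) := CircleSpace {
  bundle_total :> topologicalType;
  bproj : bundle_total -> X;
  cact : circle R -> bundle_total -> bundle_total;
  bproj_cact : forall z e, bproj (cact z e) = bproj e }.

Definition principal_circle_bundle (R : realType) (X : topologicalType)
    (B : circle_space R X) : Prop :=
  [/\ [/\ forall e : B, cact (circle_one R) e = e,
          forall z w (e : B), cact (circle_mul z w) e = cact z (cact w e) &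
          continuous (fun ze : circle R * B => cact ze.1 ze.2)],
      [/\ forall z (e : B), cact z e = e -> z = circle_one R &
          forall e e' : B, bproj e = bproj e' -> exists z, e' = cact z e],
      continuous (@bproj R X B) &
      forall x : X, exists U : set X,
        [/\ open U, U x &
          exists phi : set_type U * circle R -> B,
          [/\ homeomorphism_onto phi (@bproj R X B @^-1` U),
              forall u z, bproj (phi (u, z)) = set_val u &
              forall u z w, phi (u, circle_mul z w) = cact z (phi (u, w))]]].

Definition circle_space_iso (R : realType) (X : topologicalType)
    (B B' : circle_space R X) : Prop :=
  exists f : B -> B',
    [/\ homeomorphism_onto f setT,
        forall e, bproj (f e) = bproj e &
        forall z e, f (cact z e) = cact z (f e)].

Section Pullback.
Variables (R : realType) (X Y : topologicalType) (j : X -> Y).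
Variable P : circle_space R Y.

Definition pullback_set : set (X * P) := [set xe | j xe.1 = bproj xe.2].

Fact pullback_act_subproof (z : circle R) (xe : set_type pullback_set) :
  ((set_val xe).1, cact z (set_val xe).2) \in pullback_set.
Proof.
apply: mem_set; rewrite /pullback_set /= bproj_cact.
exact: (set_valP xe).
Qed.

Definition pullback : circle_space R X :=
  @CircleSpace R X (set_type pullback_set)
    (fun xe => (set_val xe).1)
    (fun z xe => exist (fun y => y \in pullback_set) _ (pullback_act_subproof z xe))
    (fun z xe => erefl).

End Pullback.

(* A groupoid with object space [U] and arrow space [arrow]; the unit space, as
   a set of arrows, is the range of [gunit].  [gmul] is total, but is only
   constrained on composable pairs ([gsrc x = grng y]). *)
Record groupoid (U : topologicalType) := Groupoid {
  arrow :> topologicalType;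
  grng : arrow -> U;
  gsrc : arrow -> U;
  gunit : U -> arrow;
  ginv : arrow -> arrow;
  gmul : arrow -> arrow -> arrow;
  grng_unit : forall u, grng (gunit u) = u;
  gsrc_unit : forall u, gsrc (gunit u) = u;
  grng_inv : forall x, grng (ginv x) = gsrc x;
  gsrc_inv : forall x, gsrc (ginv x) = grng x;
  grng_mul : forall x y, gsrc x = grng y -> grng (gmul x y) = grng x;
  gsrc_mul : forall x y, gsrc x = grng y -> gsrc (gmul x y) = gsrc y;
  gmulA : forall x y z, gsrc x = grng y -> gsrc y = grng z ->
    gmul x (gmul y z) = gmul (gmul x y) z;
  gmul1g : forall x, gmul (gunit (grng x)) x = x;
  gmulg1 : forall x, gmul x (gunit (gsrc x)) = x;
  gmulgV : forall x, gmul x (ginv x) = gunit (grng x);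
  gmulVg : forall x, gmul (ginv x) x = gunit (gsrc x) }.

Section GroupoidTheory.
Variable U : topologicalType.

Definition unit_space (G : groupoid U) : set G := range (gunit G).

Definition composable (G : groupoid U) : set (G * G) :=
  [set xy | gsrc xy.1 = grng xy.2].

Arguments unit_space : clear implicits.
Arguments composable : clear implicits.

(* Continuity of [gunit] and [grng] makes [U] homeomorphic to [unit_space G]. *)
Definition topological_groupoid (G : groupoid U) : Prop :=
  [/\ continuous (@grng U G), continuous (@gsrc U G), continuous (gunit G),
      continuous (@ginv U G) &
      {within composable G, continuous (fun xy => gmul xy.1 xy.2)}].

Definition locally_compact_groupoid (G : groupoid U) : Prop :=
  [/\ topological_groupoid G, @second_countable G,
      locally_compact [set: G] & hausdorff_space G].

Definition etale_groupoid (G : groupoid U) : Prop :=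
  locally_compact_groupoid G /\ local_homeomorphism (@grng U G).

(* Homomorphisms between groupoids with the same unit space are understood to
   be the identity on units. *)
Definition groupoid_hom (G H : groupoid U) (f : G -> H) : Prop :=
  [/\ forall x, grng (f x) = grng x,
      forall x, gsrc (f x) = gsrc x,
      forall u, f (gunit G u) = gunit H u &
      forall x y, gsrc x = grng y -> f (gmul x y) = gmul (f x) (f y)].

End GroupoidTheory.

Arguments unit_space {U} G _.
Arguments composable {U} G _.

Definition circle_groupoid (R : realType) (U : topologicalType) : groupoid U.
Proof.
apply: (@Groupoid U (circle R * U)%type (fun x => x.2) (fun x => x.2)
  (fun u => (circle_one R, u)) (fun x => (circle_inv x.1, x.2))
  (fun x y => (circle_mul x.1 y.1, x.2))) => //.
- by move=> x y z _ _ /=; rewrite circle_mulA.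
- by case=> z u /=; rewrite circle_mul1.
- by case=> z u /=; rewrite circle_mulC circle_mul1.
- by case=> z u /=; rewrite circle_mulV.
- by case=> z u /=; rewrite circle_mulC circle_mulV.
Defined.

Record topological_twist (R : realType) (U : topologicalType)
    (G : groupoid U) := TopologicalTwist {
  twist_groupoid : groupoid U;
  twist_i : circle_groupoid R U -> twist_groupoid;
  twist_p : twist_groupoid -> G;
  twist_etale : etale_groupoid G;
  twist_locally_compact : locally_compact_groupoid twist_groupoid;
  twist_i_hom : groupoid_hom twist_i;
  twist_p_hom : groupoid_hom twist_p;
  twist_i_homeo : homeomorphism_onto twist_i (twist_p @^-1` unit_space G);
  twist_p_continuous : continuous twist_p;
  twist_p_open : open_map twist_p;
  twist_p_surj : range twist_p = setT;
  twist_p_sections : forall g : G, exists V : set G,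
    [/\ open V, V g &
      exists2 s : set_type V -> twist_groupoid,
        continuous s & forall v, twist_p (s v) = set_val v];
  twist_central : forall (z : circle R) (x : twist_groupoid),
    gmul (gmul x (twist_i (z, gsrc x))) (ginv x) = twist_i (z, grng x) }.

Section TwistBundle.
Variables (R : realType) (U : topologicalType) (G : groupoid U).
Variable L : topological_twist R G.

Definition twist_act (z : circle R) (x : twist_groupoid L) : twist_groupoid L :=
  gmul (twist_i L (z, grng x)) x.

Lemma twist_p_act z x : twist_p (twist_act z x) = twist_p x.
Proof.
have [_ si _ _] := twist_i_hom L.
have [rp sp _ mp] := twist_p_hom L.
rewrite /twist_act mp; last by rewrite si.
have [u _ E] : (@twist_p _ _ _ L @^-1` unit_space G) (twist_i L (z, grng x)).
  by have [_ _ <- _] := twist_i_homeo L; exists (z, grng x).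
have -> : twist_p (twist_i L (z, grng x)) = gunit G (grng (twist_p x)).
  by rewrite -E rp; congr gunit; rewrite -[u](@gsrc_unit _ G) E sp si.
exact: gmul1g.
Qed.

Definition twist_bundle : circle_space R G :=
  @CircleSpace R G (twist_groupoid L) (@twist_p _ _ _ L) twist_act twist_p_act.

End TwistBundle.

Section RenaultDeaconu.
Variables (T : topologicalType) (D : set T) (sigma : T -> T).

(* A partial map is a domain [D] and a function [sigma : T -> T] whose values
   outside [D] are irrelevant; its range is [sigma @` D]. *)
Definition partial_local_homeomorphism : Prop :=
  [/\ open D, open (sigma @` D) &
      local_homeomorphism (fun t : set_type D => sigma (set_val t))].

Definition iter_dom (k : nat) : set T :=
  [set t | forall i, (i < k)%N -> D (iter i sigma t)].

Definition rd_rel (k1 k2 : nat) (t1 t2 : T) : Prop :=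
  [/\ iter_dom k1 t1, iter_dom k2 t2 & iter k1 sigma t1 = iter k2 sigma t2].

Record rd_arrow := RDArrow {
  rd_left : T;
  rd_deg : int;
  rd_right : T;
  rd_cond : exists k1 k2 : nat,
    rd_deg = k1%:Z - k2%:Z /\ rd_rel k1 k2 rd_left rd_right }.

HB.instance Definition _ := gen_eqMixin rd_arrow.
HB.instance Definition _ := gen_choiceMixin rd_arrow.

Definition rd_open_index : set ((set T * nat) * (set T * nat)) :=
  [set UV | [/\ open UV.1.1, UV.1.1 `<=` iter_dom UV.1.2 &
                {in UV.1.1 &, injective (iter UV.1.2 sigma)}] /\
            [/\ open UV.2.1, UV.2.1 `<=` iter_dom UV.2.2 &
                {in UV.2.1 &, injective (iter UV.2.2 sigma)}]].

Definition rd_open (UV : (set T * nat) * (set T * nat)) : set rd_arrow :=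
  [set g | [/\ rd_deg g = UV.1.2%:Z - UV.2.2%:Z,
               UV.1.1 (rd_left g), UV.2.1 (rd_right g) &
               iter UV.1.2 sigma (rd_left g) = iter UV.2.2 sigma (rd_right g)]].

HB.instance Definition _ :=
  isSubBaseTopological.Build rd_arrow rd_open_index rd_open.

Lemma rd_arrow_eq (g h : rd_arrow) :
  rd_left g = rd_left h -> rd_deg g = rd_deg h -> rd_right g = rd_right h ->
  g = h.
Proof.
case: g h => [a n b c] [a' n' b' c'] /= ea en eb; subst.
by congr RDArrow; exact: Prop_irrelevance.
Qed.

Lemma iter_domD k l t :
  iter_dom (k + l) t <-> iter_dom k t /\ iter_dom l (iter k sigma t).
Proof.
split=> [dt|[dk dl] i lt_i]; first split=> i lt_i.
- by apply: dt; rewrite (leq_trans lt_i) ?leq_addr.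
- by rewrite -iterD addnC; apply: dt; rewrite ltn_add2l.
case: (ltnP i k) => [/dk //|le_ki].
by rewrite -(subnK le_ki) iterD; apply: dl; lia.
Qed.

Lemma rd_relD k1 k2 l t1 t2 : iter_dom (k2 + l) t2 ->
  rd_rel k1 k2 t1 t2 -> rd_rel (k1 + l) (k2 + l) t1 t2.
Proof.
move=> /iter_domD[_ dl] [d1 d2 e]; split.
- by apply/iter_domD; rewrite e.
- by apply/iter_domD.
- by rewrite addnC iterD e -iterD addnC.
Qed.

Lemma rd_rel_sym k1 k2 t1 t2 : rd_rel k1 k2 t1 t2 -> rd_rel k2 k1 t2 t1.
Proof. by case. Qed.

Fact rd_unit_cond t : exists k1 k2 : nat,
  0 = k1%:Z - k2%:Z /\ rd_rel k1 k2 t t.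
Proof. by exists 0%N, 0%N; rewrite subrr. Qed.

Fact rd_inv_cond g : exists k1 k2 : nat,
  - rd_deg g = k1%:Z - k2%:Z /\ rd_rel k1 k2 (rd_right g) (rd_left g).
Proof.
case: g => t1 n t2 /= [k1 [k2 [-> r]]]; exists k2, k1; rewrite opprB.
by split=> //; exact: rd_rel_sym.
Qed.

Fact rd_mul_cond g h : rd_right g = rd_left h -> exists k1 k2 : nat,
  rd_deg g + rd_deg h = k1%:Z - k2%:Z /\
  rd_rel k1 k2 (rd_left g) (rd_right h).
Proof.
case: g h => t1 n t2 /= [k1 [k2 [-> r]]] [t2' m t3 /= [l1 [l2 [-> r']]]] E.
subst t2'; case: (leqP l1 k2) => [le|/ltnW le].
- exists k1, (l2 + (k2 - l1))%N; split; first by lia.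
  have [_ d2 e] := r.
  have [] : rd_rel k2 (l2 + (k2 - l1)) t2 t3.
    have -> : k2 = (l1 + (k2 - l1))%N by lia.
    have -> : (l1 + (k2 - l1) - l1 = k2 - l1)%N by lia.
    apply: rd_rel_sym; apply: rd_relD; last exact: rd_rel_sym.
    by have -> : (l1 + (k2 - l1) = k2)%N by lia.
  by move=> _ d3 e'; split=> //; [case: r | rewrite e].
- exists (k1 + (l1 - k2))%N, l2; split; first by lia.
  have [d2 d3 e] := r'.
  have [] : rd_rel (k1 + (l1 - k2)) l1 t1 t2.
    have -> : l1 = (k2 + (l1 - k2))%N by lia.
    have -> : (k2 + (l1 - k2) - k2 = l1 - k2)%N by lia.
    apply: rd_relD => //.
    by have -> : (k2 + (l1 - k2) = l1)%N by lia.
  by move=> d1 _ e'; split=> //; rewrite e'.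
Qed.

Definition rd_unit (t : T) : rd_arrow := RDArrow (rd_unit_cond t).

Definition rd_inv (g : rd_arrow) : rd_arrow := RDArrow (rd_inv_cond g).

Definition rd_mul (g h : rd_arrow) : rd_arrow :=
  if pselect (rd_right g = rd_left h) is left E
  then RDArrow (rd_mul_cond E) else g.

Lemma rd_mulP g h : rd_right g = rd_left h ->
  [/\ rd_left (rd_mul g h) = rd_left g,
      rd_deg (rd_mul g h) = rd_deg g + rd_deg h &
      rd_right (rd_mul g h) = rd_right h].
Proof. by rewrite /rd_mul => E; case: pselect. Qed.

(* The unit space [{(t, 0, t)}] is identified with [T]. *)
Definition renault_deaconu : groupoid T.
Proof.
apply: (@Groupoid T rd_arrow rd_left rd_right rd_unit rd_inv rd_mul) => //.
- by move=> x y /rd_mulP[].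
- by move=> x y /rd_mulP[].
- move=> x y z xy yz.
  have [l1 d1 r1] := rd_mulP xy; have [l2 d2 r2] := rd_mulP yz.
  have [|l3 d3 r3] := @rd_mulP x (rd_mul y z); first by rewrite l2.
  have [|l4 d4 r4] := @rd_mulP (rd_mul x y) z; first by rewrite r1.
  apply: rd_arrow_eq; first by rewrite l3 l4 l1.
    by rewrite d3 d4 d1 d2 addrA.
  by rewrite r3 r4 r2.
- move=> x; have [|l d r] := @rd_mulP (rd_unit (rd_left x)) x; first by [].
  by apply: rd_arrow_eq; rewrite ?l ?d ?r //= add0r.
- move=> x; have [|l d r] := @rd_mulP x (rd_unit (rd_right x)); first by [].
  by apply: rd_arrow_eq; rewrite ?l ?d ?r //= addr0.
- move=> x; have [|l d r] := @rd_mulP x (rd_inv x); first by [].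
  by apply: rd_arrow_eq; rewrite ?l ?d ?r //= subrr.
- move=> x; have [|l d r] := @rd_mulP (rd_inv x) x; first by [].
  by apply: rd_arrow_eq; rewrite ?l ?d ?r //= addNr.
Defined.

Fact rd_embed_cond (t : set_type D) : exists k1 k2 : nat,
  1 = k1%:Z - k2%:Z /\ rd_rel k1 k2 (set_val t) (sigma (set_val t)).
Proof.
exists 1%N, 0%N; rewrite subr0; split=> //; split=> //.
by case=> // _; exact: set_valP.
Qed.

Definition rd_embed (t : set_type D) : renault_deaconu :=
  RDArrow (rd_embed_cond t).

End RenaultDeaconu.

(* Main.v *)
(* A set-theoretic section of [B] identifies [B] with [D * circle] as a set and,
   multiplied along orbits of [sigma], would identify the twist with
   [Gamma * circle] as a groupoid.  So take that product groupoid and twist only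
   its topology: the chart at [(t1, k - l, t2)] divides the circle coordinate over
   [(x1, k - l, x2)] by
   prod_(i < k) a_i(sigma^i x1) / prod_(j < l) b_j(sigma^j x2), where a_i and b_j
   compare continuous local sections of [B] near [sigma^i t1] and [sigma^j t2]
   with the chosen section.  Passing from lags (k, l) to (k + m, l + m) multiplies
   both products by the same factor, because [sigma^k x1 = sigma^l x2], so the
   charts are compatible. *)

(* The fibre of the twist over an arrow is morally a tensor product of fibres of [B] along the orbit
   of the range and of dual fibres along the orbit of the source. Gluing such products from
   transition functions would put the difficulty into associativity and into independence of the
   lags. Here the algebra is that of a product, and all the difficulty is moved to continuity.

   The price is that the chosen section, hence each comparison factor, is in general discontinuous,
   since [B] may have no global continuous section. No gauge is therefore ever asserted to be
   continuous. Only quotients of two gauges are, and only at a given point; this is [gauge_equiv].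

   Fixed lags also govern the base: the arrows with lags (k, l) form an open set that carries the
   topology induced from T x T, so gauges built from the two endpoints can be compared there.

   The pullback recovers [B] because j(t) has lags (1, 0): the source product is empty, the range
   product is the single factor a_0(t), and dividing by it turns the coordinate relative to the
   chosen section into the one relative to a continuous local section. *)
Require Import Defs.
From HB Require Import structures.
From mathcomp Require Import all_boot all_order all_algebra.
From mathcomp Require Import zify ring lra.
From mathcomp Require Import all_classical all_reals topology normedtype.

Set Implicit Arguments.
Unset Strict Implicit.
Unset Printing Implicit Defensive.

Import Order.TTheory GRing.Theory Num.Theory.
Import numFieldNormedType.Exports.

Local Open Scope classical_set_scope.
Local Open Scope ring_scope.
Local Open Scope complex_scope.

(** * Topological preliminaries *)

Section General.

Lemma nbhs_set_type (X : topologicalType) (A : set X) (x : set_type A)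
    (N : set (set_type A)) :
  nbhs x N <-> exists2 M, nbhs (set_val x) M & set_val @^-1` M `<=` N.
Proof.
split=> [[_ [[W oW <-] Wx sN]]|[M Mx sN]].
  by exists W => //; exact: open_nbhs_nbhs.
by apply: filterS sN _; exact: initial_continuous.
Qed.

Lemma continuous_set_type (X Z : topologicalType) (A : set X)
    (f : Z -> set_type A) (z : Z) :
  {for z, continuous (set_val \o f)} -> {for z, continuous f}.
Proof.
move=> cf N /nbhs_set_type[M /cf FM sN].
by apply: (@filterS _ (nbhs z) _ _ _ _ FM) => y; exact: sN.
Qed.

Lemma countable_image (X Y : Type) (f : X -> Y) (A : set X) :
  countable A -> countable (f @` A).
Proof. exact/sub_countable/card_image_le. Qed.

Lemma compact_set_type (X : topologicalType) (A : set X) :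
  compact A -> compact [set: set_type A].
Proof.
move=> cA F FF _; have FA : (set_val @ F) A.
  by rewrite /nbhs/=; apply: filterE => a; exact: set_valP.
have [p [Ap clp]] := cA _ _ FA.
exists (exist _ p (mem_set Ap)); split=> // P N FP /nbhs_set_type[M Mp sN].
have FP' : (set_val @ F) (set_val @` P).
  by apply: (@filterS _ F _ _ _ _ FP) => q Pq; exists q.
have [_ [[q Pq <-] Mq]] := clp _ _ FP' Mp.
by exists q; split=> //; exact: sN.
Qed.

Lemma continuous_fst (X Y : topologicalType) : continuous (fst : X * Y -> X).
Proof. by move=> p; exact: cvg_fst. Qed.

Lemma continuous_snd (X Y : topologicalType) : continuous (snd : X * Y -> Y).
Proof. by move=> p; exact: cvg_snd. Qed.

Lemma continuous_set_val_fst (X Y : topologicalType) (A : set (X * Y)) :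
  continuous (fun v : set_type A => (set_val v).1).
Proof.
move=> v; apply: (continuous_comp (f := set_val) (g := fst)).
  exact: initial_continuous.
exact: continuous_fst.
Qed.

Lemma continuous_set_val_snd (X Y : topologicalType) (A : set (X * Y)) :
  continuous (fun v : set_type A => (set_val v).2).
Proof.
move=> v; apply: (continuous_comp (f := set_val) (g := snd)).
  exact: initial_continuous.
exact: continuous_snd.
Qed.

Lemma continuous_pair (X Y Z : topologicalType) (f : Z -> X) (g : Z -> Y) z :
  {for z, continuous f} -> {for z, continuous g} ->
  {for z, continuous (fun y => (f y, g y))}.
Proof. by move=> cf cg; exact: cvg_pair. Qed.

(** Local compactness provides a single compact neighbourhood; regularity shrinks it into [N].
    Regularity is deduced from complete regularity, which is how [R] enters. *)
Lemma locally_compact_nbhs (R : realType) (X : topologicalType) (x : X) N :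
  hausdorff_space X -> locally_compact [set: X] -> nbhs x N ->
  exists K, [/\ nbhs x K, compact K, closed K & K `<=` N].
Proof.
move=> hX lcX.
have regX : @regular_space X.
  exact: (@completely_regular_regular R X
    (@locally_compact_completely_regular X R lcX hX)).
move=> /regX[B xB sB]; have [K + [cK clK]] := lcX x I.
rewrite withinET => xK; exists (K `&` closure B); split.
- by apply: filterI => //; apply: filterS xB; exact: subset_closure.
- by apply: compact_closedI => //; exact: closed_closure.
- by apply: closedI => //; exact: closed_closure.
- by move=> y [_ /sB].
Qed.

(** Hausdorffness is expressed by clustering of neighbourhood filters, so this separates points one
    coordinate at a time. Continuity is asked at [p] and [q] only, because circle coordinates in a
    chart are controlled only pointwise. *)
Lemma cluster_continuous (X Y : topologicalType) (f : X -> Y) (p q : X) :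
  hausdorff_space Y -> {for p, continuous f} -> {for q, continuous f} ->
  cluster (nbhs p) q -> f p = f q.
Proof.
move=> hY cp cq clpq; apply: hY => P Q /cp Pp /cq Qq.
by have [x [Px Qx]] := clpq _ _ Pp Qq; exists (f x).
Qed.

Lemma second_countable_prod (X Y : topologicalType) :
  @second_countable X -> @second_countable Y -> @second_countable (X * Y)%type.
Proof.
move=> [A cA [oA bA]] [B cB [oB bB]].
exists [set U.1 `*` U.2 | U in A `*` B].
  by apply: countable_image; exact: countableX.
split=> [_ [U [AU BU] <-]|[x y] N].
  rewrite openE => p [p1 p2]; exists (U.1, U.2) => //=.
  by split; apply: open_nbhs_nbhs; split=> //; [exact: oA|exact: oB].
move=> [[P Q] /= [/bA[U [AU Ux] sP] /bB[V [BV Vy] sQ]] sN].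
exists (U `*` V); first by split; [exists (U, V)|].
by move=> p [p1 p2]; apply: sN; split; [exact: sP|exact: sQ].
Qed.

Lemma second_countable_inducing (X Y : topologicalType) (f : X -> Y) :
  continuous f ->
  (forall x N, nbhs x N -> exists2 M, nbhs (f x) M & f @^-1` M `<=` N) ->
  @second_countable Y -> @second_countable X.
Proof.
move=> cf indf [B cB [oB bB]]; exists [set f @^-1` U | U in B].
  exact: countable_image.
split=> [_ [U BU <-]|x N /indf[M /bB[U [BU Ux] sM] sN]].
  by apply: open_comp => [p _|]; [exact: cf|exact: oB].
by exists (f @^-1` U); [split=> //; exists U|move=> y /sM; exact: sN].
Qed.

Lemma second_countable_real (R : realType) : @second_countable R^o.
Proof.
pose b (q : rat * rat) : set R^o := [set x | ratr q.1 < x < ratr q.2].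
exists (b @` setT).
  by apply: countable_image; exact: countableP.
split=> [_ [q _ <-]|x N /nbhs_ballP[e /= e0 sN]].
  have -> : b q = `]ratr q.1, ratr q.2[%classic.
    by apply/seteqP; split=> x; rewrite /b/= in_itv.
  exact: itv_open.
have /rat_in_itvoo[a /itvP xa] : x - e < x by rewrite ltrBlDr ltrDl.
have /rat_in_itvoo[c /itvP xc] : x < x + e by rewrite ltrDl.
exists (b (a, c)); first by split; [exists (a, c)|rewrite /b/= xa xc].
move=> y; rewrite /b/= => /andP[ay yc]; apply: sN.
rewrite /ball/= ltr_distlC.
by rewrite (lt_trans _ ay) ?xa//= (lt_trans yc)// xc.
Qed.

End General.

(** * The topology of the circle *)

Section Circle.
Variable R : realType.

Lemma nbhs_complex (z : R[i]^o) (A : set R[i]^o) :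
  nbhs z A <-> exists2 e : R, 0 < e &
    forall w : R[i], `|complex.Re z - complex.Re w| < e ->
      `|complex.Im z - complex.Im w| < e -> A w.
Proof.
split=> [/nbhs_ballP[[e i] /= ]|[e e0 sA]].
  (* Radii in [R[i]^o] are complex, and positivity forces a zero imaginary part. Half the radius in
     each coordinate suffices, as 2 (e/2)^2 < e^2. *)
  rewrite ltcE/= => /andP[/eqP i0 e0] sA; exists (e / 2); first lra.
  move=> w r1 i1; apply: sA; rewrite /ball/= normc_def ltcE /= i0 eqxx /=.
  case: z w r1 i1 => [a b] [c d] /= r1 i1.
  rewrite -(@ger0_norm _ e) ?ltW// -sqrtr_sqr ltr_sqrt ?exprn_gt0//.
  rewrite -(real_normK (num_real (a - c))) -(real_normK (num_real (b - d))).
  have := normr_ge0 (a - c); have := normr_ge0 (b - d).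
  by move: r1 i1; set x := `|_|; set y := `|_|; nra.
apply/nbhs_ballP; exists e%:C => /=; first by rewrite ltcR.
move=> w; rewrite /ball/= normc_def ltcR => h.
have h1 (x y : R) : Num.sqrt (x ^+ 2 + y ^+ 2) < e -> `|x| < e /\ `|y| < e.
  move=> h1; split; apply: le_lt_trans h1;
    rewrite -sqrtr_sqr ler_sqrt ?addr_ge0 ?sqr_ge0//.
  - by rewrite lerDl sqr_ge0.
  - by rewrite lerDr sqr_ge0.
by case: z w h sA => [a b] [c d] /= /h1[r1 i1]; apply.
Qed.

Definition circle_coord (z : circle R) : (R^o * R^o)%type :=
  (complex.Re (set_val z : R[i]), complex.Im (set_val z : R[i])).

Lemma circle_coord_continuous : continuous circle_coord.
Proof.
move=> z N [[P Q] /= [/nbhs_ballP[e /= e0 sP] /nbhs_ballP[f /= f0 sQ]] sN].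
apply/nbhs_set_type.
exists [set w : R[i] | N (complex.Re w, complex.Im w)] => //.
apply/nbhs_complex; exists (Num.min e f); first by rewrite lt_min e0.
move=> w; rewrite !lt_min => /andP[h1 _] /andP[_ h2] /=.
by apply: sN; split; [exact: sP|exact: sQ].
Qed.

Lemma circle_coord_inducing (z : circle R) N : nbhs z N ->
  exists2 M, nbhs (circle_coord z) M & circle_coord @^-1` M `<=` N.
Proof.
move=> /nbhs_set_type[M /nbhs_complex[e e0 sM] sN].
exists (ball (circle_coord z).1 e `*` ball (circle_coord z).2 e).
  by eexists (_, _); last exact: subset_refl; split; exact: nbhsx_ballx.
by move=> w [h1 h2]; apply: sN; exact: sM.
Qed.

Lemma circle_second_countable : @second_countable (circle R).
Proof.
apply: second_countable_inducing circle_coord_continuous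
  circle_coord_inducing _.
by apply: second_countable_prod; exact: second_countable_real.
Qed.

Lemma circle_hausdorff : hausdorff_space (circle R).
Proof.
move=> p q clpq; apply: val_inj.
apply: (cluster_continuous (f := set_val) (@norm_hausdorff _ R[i]^o)) clpq;
  exact: initial_continuous.
Qed.

(** Heine-Borel in the plane: the circle is the continuous image of a closed subset of the square
    [-1, 1]^2. *)
Lemma circle_compact : compact [set: circle R].
Proof.
apply: compact_set_type.
pose f (p : R^o * R^o) : R[i]^o := p.1 +i* p.2.
have cf : continuous f.
  move=> p N /nbhs_complex[e e0 sN]; exists (ball p.1 e, ball p.2 e) => /=.
    by split; exact: nbhsx_ballx.
  by move=> q [h1 h2]; exact: sN.
pose n (p : R^o * R^o) : R^o := p.1 * p.1 + p.2 * p.2.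
have cn : continuous n.
  move=> p; apply: cvgD; apply: cvgM; first [exact: cvg_fst|exact: cvg_snd].
have -> : unit_circle R = f @` (n @^-1` [set 1]).
  apply/seteqP; split=> [[a b]|_ [[a b] /= nab <-]];
    rewrite /unit_circle/= normc_def /=.
    move=> /(congr1 (@complex.Re R)) /= h; exists (a, b) => //=; rewrite /n/=.
    rewrite -!expr2 -(@sqr_sqrtr _ (_ + _)) ?addr_ge0 ?sqr_ge0//.
    by rewrite h expr1n.
  by move: nab; rewrite /n/= -!expr2 => ->; rewrite sqrtr1.
apply: continuous_compact; first exact: continuous_subspaceT.
have cI : compact (`[-1, 1]%classic : set R^o) by exact: segment_compact.
apply: subclosed_compact (compact_setX cI cI) _.
- by apply: closed_comp => [p _|]; [exact: cn|exact: closed_eq].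
- move=> [a b]; rewrite /n/= => h; split; rewrite /= in_itv/=; nra.
Qed.

Lemma circle_mul_continuous :
  continuous (fun zw : circle R * circle R => circle_mul zw.1 zw.2).
Proof.
move=> p; apply: continuous_set_type.
have cv := @initial_continuous _ _ (set_val : circle R -> R[i]^o).
have cf : {for p, continuous (fun q => set_val q.1 : R[i]^o)}.
  by apply: (continuous_comp (f := fst)) (cv _); exact: continuous_fst.
have cs : {for p, continuous (fun q => set_val q.2 : R[i]^o)}.
  by apply: (continuous_comp (f := snd)) (cv _); exact: continuous_snd.
exact: (@cvgM R[i] _ _ _ _ _ _ _ cf cs).
Qed.

Lemma circle_inv_continuous : continuous (@circle_inv R).
Proof.
move=> p; apply: continuous_set_type.
have cv := @initial_continuous _ _ (set_val : circle R -> R[i]^o).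
apply: (@continuous_comp _ _ _ _ (fun x : R[i]^o => x^-1 : R[i]^o) _ (cv p)).
apply: (@inv_continuous R[i]).
by rewrite -normr_eq0 circle_norm oner_neq0.
Qed.

End Circle.

Notation "z *c w" := (circle_mul z w) (at level 40, left associativity).
Notation "z /c w" := (circle_mul z (circle_inv w))
  (at level 40, left associativity).

Section CircleField.
Variable R : realType.
Implicit Types z w : circle R.

Definition circle_val z : R[i] := set_val z.

Lemma circle_val_inj : injective circle_val.
Proof. by move=> z w /val_inj. Qed.

Lemma circle_val_mul z w : circle_val (z *c w) = circle_val z * circle_val w.
Proof. by []. Qed.

Lemma circle_val_inv z : circle_val (circle_inv z) = (circle_val z)^-1.
Proof. by []. Qed.

Lemma circle_val_one : circle_val (circle_one R) = 1.
Proof. by []. Qed.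

Lemma circle_val_neq0 z : circle_val z != 0.
Proof. by rewrite -normr_eq0 [`|_|]circle_norm oner_neq0. Qed.

End CircleField.

(** Identities of the abelian group [circle R] are decided in the field [R[i]], into which the
    circle injects with nonzero values. *)
Ltac circle_field :=
  apply: circle_val_inj;
  rewrite ?(circle_val_mul, circle_val_inv, circle_val_one);
  field; by rewrite ?circle_val_neq0.

Section CircleContinuity.
Variables (R : realType) (Z : topologicalType).
Implicit Types (f g : Z -> circle R) (z : Z).

Lemma continuous_circle_mul f g z : {for z, continuous f} ->
  {for z, continuous g} -> {for z, continuous (fun y => f y *c g y)}.
Proof.
move=> cf cg; apply: (continuous_comp (continuous_pair cf cg)
  (g := fun zw : circle R * circle R => zw.1 *c zw.2)).
exact: circle_mul_continuous.
Qed.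

Lemma continuous_circle_inv f z : {for z, continuous f} ->
  {for z, continuous (fun y => circle_inv (f y))}.
Proof.
by move=> cf; apply: (continuous_comp cf); exact: circle_inv_continuous.
Qed.

(** [f] and [g] may both be discontinuous at [z]; they differ there by a continuous factor, so
    dividing a circle coordinate by either gives the same notion of continuity at [z]. *)
Definition gauge_equiv z f g := {for z, continuous (fun y => f y /c g y)}.

Lemma gauge_equiv_near z f g : (\forall y \near z, f y = g y) ->
  gauge_equiv z f g.
Proof.
move=> fg; rewrite /gauge_equiv /prop_for /continuous_at.
rewrite (nbhs_singleton fg) circle_mulV.
by apply: cvg_near_cst; apply: filterS fg => y ->; rewrite circle_mulV.
Qed.

Lemma gauge_equiv_eq z f g : f =1 g -> gauge_equiv z f g.
Proof. by move=> fg; exact/gauge_equiv_near/nearW. Qed.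

Lemma gauge_equiv_refl z f : gauge_equiv z f f.
Proof. exact: gauge_equiv_eq. Qed.

Lemma gauge_equiv_trans z g f h :
  gauge_equiv z f g -> gauge_equiv z g h -> gauge_equiv z f h.
Proof.
rewrite /gauge_equiv => fg gh.
suff -> : (fun y => f y /c h y) = (fun y => (f y /c g y) *c (g y /c h y)).
  exact: continuous_circle_mul.
by apply/funext => y; circle_field.
Qed.

Lemma gauge_equiv_sym z f g : gauge_equiv z f g -> gauge_equiv z g f.
Proof.
rewrite /gauge_equiv => fg.
suff -> : (fun y => g y /c f y) = (fun y => circle_inv (f y /c g y)).
  exact: continuous_circle_inv.
by apply/funext => y; circle_field.
Qed.

Lemma gauge_equiv_mul z f g f' g' : gauge_equiv z f g -> gauge_equiv z f' g' ->
  gauge_equiv z (fun y => f y *c f' y) (fun y => g y *c g' y).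
Proof.
rewrite /gauge_equiv => fg fg'.
suff -> : (fun y => (f y *c f' y) /c (g y *c g' y)) =
    (fun y => (f y /c g y) *c (f' y /c g' y)).
  exact: continuous_circle_mul.
by apply/funext => y; circle_field.
Qed.

Lemma gauge_equiv_inv z f g : gauge_equiv z f g ->
  gauge_equiv z (fun y => circle_inv (f y)) (fun y => circle_inv (g y)).
Proof.
move=> /gauge_equiv_sym; rewrite /gauge_equiv => fg.
suff -> : (fun y => circle_inv (f y) /c circle_inv (g y)) =
    (fun y => g y /c f y) by [].
by apply/funext => y; circle_field.
Qed.

End CircleContinuity.

Arguments gauge_equiv_refl {R Z} z f.

Lemma gauge_equiv_comp (R : realType) (Z X : topologicalType) (h : Z -> X)
    (z : Z) (f g : X -> circle R) :
  {for z, continuous h} -> gauge_equiv (h z) f g ->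
  gauge_equiv z (f \o h) (g \o h).
Proof. by move=> ch; exact: continuous_comp. Qed.

(** * Products with the circle whose topology is twisted by gauges *)

Section TwistedProduct.
Variables (R : realType) (X : topologicalType).
Implicit Types (a b : X -> circle R) (A : X -> X -> circle R).

Definition coherent A :=
  forall x, \forall y \near x, gauge_equiv y (A x) (A y).

Definition chart a (p : X * circle R) : X * circle R := (p.1, p.2 /c a p.1).
Definition unchart a (p : X * circle R) : X * circle R := (p.1, p.2 *c a p.1).

Lemma chartK a : cancel (chart a) (unchart a).
Proof. by case=> x w; congr pair => /=; circle_field. Qed.

Lemma unchartK a : cancel (unchart a) (chart a).
Proof. by case=> x w; congr pair => /=; circle_field. Qed.

(** The change of charts multiplies the circle coordinate by a / b, a factor continuous at [p.1]. *)
Lemma unchart_nbhs_sub a b p : gauge_equiv p.1 a b ->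
  (unchart b @ nbhs (chart b p)) `<=` (unchart a @ nbhs (chart a p)).
Proof.
move=> ab N Nb; have cba : {for chart a p, continuous (chart b \o unchart a)}.
  suff -> : chart b \o unchart a =
      (fun q => (q.1, q.2 *c (a q.1 /c b q.1))).
    apply: continuous_pair; first exact: continuous_fst.
    apply: continuous_circle_mul; first exact: continuous_snd.
    apply: (gauge_equiv_comp (h := fst) (z := chart a p)) ab.
    exact: continuous_fst.
  by apply/funext => -[x w] /=; congr pair => /=; circle_field.
have := cba (unchart b @^-1` N); rewrite /= chartK => /(_ Nb) Na.
apply: (@filterS _ (nbhs (chart a p)) _ _ _ _ Na) => q /=.
by rewrite chartK.
Qed.

(* The gauge [A x] serves as a chart near [x]; coherence says that the gauges of
   nearby points induce the same neighbourhoods. *)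
Definition twisted A & coherent A : Type := (X * circle R)%type.

Section Topology.
Variables (A : X -> X -> circle R) (cohA : coherent A).

Definition twisted_nbhs (p : twisted cohA) : set_system (twisted cohA) :=
  unchart (A p.1) @ nbhs (chart (A p.1) p).

Lemma twisted_nbhs_gauge a (p : twisted cohA) : gauge_equiv p.1 a (A p.1) ->
  twisted_nbhs p = unchart a @ nbhs (chart a p).
Proof.
move=> ap; apply/seteqP; split; apply: unchart_nbhs_sub => //.
exact: gauge_equiv_sym.
Qed.

Lemma twisted_nbhs_filter p : ProperFilter (twisted_nbhs p).
Proof. exact: fmap_proper_filter. Qed.

Lemma twisted_nbhs_singleton p N : twisted_nbhs p N -> N p.
Proof. by move/nbhs_singleton; rewrite /= chartK. Qed.

(** Coherence enters here: for [q] near [p], the neighbourhoods of [q] may be computed with the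
    gauge of [p], and in that one chart the claim is the one for the product topology. *)
Lemma twisted_nbhs_nbhs p N :
  twisted_nbhs p N -> twisted_nbhs p (twisted_nbhs^~ N).
Proof.
move=> /nbhs_interior pN.
have pA := @continuous_fst _ _ (chart (A p.1) p) _ (cohA p.1).
apply: (@filterS _ (nbhs (chart (A p.1) p)) _ _ _ _ (filterI pN pA)).
move=> q /= [Nq eq].
rewrite -/(twisted_nbhs (unchart (A p.1) q)) (@twisted_nbhs_gauge (A p.1))//.
by rewrite unchartK.
Qed.

HB.instance Definition _ := Choice.on (twisted cohA).
HB.instance Definition _ := hasNbhs.Build (twisted cohA) twisted_nbhs.
HB.instance Definition _ := Nbhs_isNbhsTopological.Build (twisted cohA)
  twisted_nbhs_filter twisted_nbhs_singleton twisted_nbhs_nbhs.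

Lemma nbhs_twisted a (p : twisted cohA) : gauge_equiv p.1 a (A p.1) ->
  nbhs p = unchart a @ nbhs (chart a p).
Proof. exact: twisted_nbhs_gauge. Qed.

Lemma continuous_chart a (p : twisted cohA) : gauge_equiv p.1 a (A p.1) ->
  {for p, continuous (chart a : twisted cohA -> X * circle R)}.
Proof.
move=> /nbhs_twisted ap N Np; suff : nbhs p (chart a @^-1` N) by [].
rewrite ap; apply: (@filterS _ (nbhs (chart a p)) _ _ _ _ Np) => q Nq.
by rewrite /= unchartK.
Qed.

Lemma continuous_twisted_fst : continuous (fst : twisted cohA -> X).
Proof.
move=> p; have cp := continuous_chart (gauge_equiv_refl p.1 (A p.1)).
by apply: (continuous_comp cp (g := fst)); exact: continuous_fst.
Qed.

Lemma continuous_twisted_snd a (p : twisted cohA) :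
  gauge_equiv p.1 a (A p.1) ->
  {for p, continuous (fun q : twisted cohA => q.2 /c a q.1)}.
Proof.
move=> /continuous_chart cp.
by apply: (continuous_comp cp (g := snd)); exact: continuous_snd.
Qed.

Lemma continuous_twisted_pair (Z : topologicalType) (f : Z -> X)
    (w : Z -> circle R) a z : gauge_equiv (f z) a (A (f z)) ->
  {for z, continuous f} -> {for z, continuous (fun y => w y /c a (f y))} ->
  {for z, continuous (fun y => (f y, w y) : twisted cohA)}.
Proof.
move=> az cf cw; have cg := continuous_pair cf cw.
rewrite /prop_for /continuous_at (nbhs_twisted (a := a)) // => N Nz.
have := cg _ Nz; apply: (@filterS _ (nbhs z)) => y /=.
by rewrite -[(f y, _)]/(chart a (f y, w y)) chartK.
Qed.

Lemma twisted_fst_open : open_map (fst : twisted cohA -> X).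
Proof.
move=> O; rewrite !openE => oO _ [p Op <-].
have [[P Q] /= [Pp Qp] sPQ] := oO _ Op.
apply: filterS Pp => x Px; have /nbhs_singleton Qp' := Qp.
by exists (unchart (A p.1) (x, p.2 /c A p.1 p.1)) => //; exact: sPQ.
Qed.

(** Points that cluster have the same base point, so a single chart is valid at both, and their
    coordinates in it agree because the circle is Hausdorff. *)
Lemma twisted_hausdorff : hausdorff_space X -> hausdorff_space (twisted cohA).
Proof.
move=> hX p q clpq.
have pq : p.1 = q.1.
  by apply: (cluster_continuous hX _ _ clpq); exact: continuous_twisted_fst.
have : p.2 /c A p.1 p.1 = q.2 /c A p.1 q.1.
  apply: (cluster_continuous (@circle_hausdorff R) _ _ clpq
    (f := fun r : twisted cohA => r.2 /c A p.1 r.1));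
    apply: continuous_twisted_snd; rewrite -?pq; exact: gauge_equiv_refl.
case: p q pq {clpq} => [x w] [_ v] /= <- /(congr1 (fun z => z *c A x x)) e.
congr pair; have -> : w = w /c A x x *c A x x by circle_field.
by rewrite e; circle_field.
Qed.

(** The neighbourhood is [K] times the circle, read in the chart at [p]. [K] lies where the gauge of
    [p] is equivalent to the local ones, so [unchart] is continuous on it. *)
Lemma twisted_locally_compact : hausdorff_space X ->
  locally_compact [set: X] -> locally_compact [set: twisted cohA].
Proof.
move=> hX lcX p _; pose a := A p.1.
have [K [pK cK _ sK]] := locally_compact_nbhs R hX lcX (cohA p.1).
pose C : set (twisted cohA) := unchart a @` (K `*` [set: circle R]).
have cC : compact C.
  apply: continuous_compact; last first.
    by apply: compact_setX => //; exact: circle_compact.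
  apply: continuous_in_subspaceT => -[x z] /set_mem[/= Kx _].
  rewrite /unchart /=.
  apply: (@continuous_twisted_pair _ _ _ a).
  - exact: sK.
  - exact: continuous_fst.
  - suff -> : (fun y : X * circle R => y.2 *c a y.1 /c a y.1) = snd.
      exact: continuous_snd.
    by apply/funext => -[y w] /=; circle_field.
exists C; last first.
  by split=> //; apply: compact_closed => //; exact: twisted_hausdorff.
rewrite withinET (@nbhs_twisted a); last exact: gauge_equiv_refl.
exists (K, setT) => /=; first by split=> //; exact: filterT.
by move=> q Kq; exists q.
Qed.

(* Every basic open set [U] carrying some gauge is given one gauge [g U];
   the charts [g U] then suffice, so no Lindelof argument is needed. *)
Lemma twisted_second_countable :
  @second_countable X -> @second_countable (twisted cohA).
Proof.
move=> [W cW [oW bW]]; have [V cV [oV bV]] := circle_second_countable R.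
pose good (U : set X) := exists x, forall y, U y -> gauge_equiv y (A x) (A y).
have /choice[g gP] : forall U : set X, exists a : X -> circle R, good U ->
    forall y, U y -> gauge_equiv y a (A y).
  move=> U; have [[x Ux]|nU] := pselect (good U); first by exists (A x).
  by exists (fun=> circle_one R).
pose base (I : (set X * set X) * set (circle R)) : set (twisted cohA) :=
  unchart (g I.1.1) @` ((I.1.1 `&` I.1.2) `*` I.2).
exists (base @` (((good `&` W) `*` W) `*` V)).
  apply: countable_image; apply: countableX => //; apply: countableX => //.
  exact: sub_countable (subset_card_le (@subIsetr _ _ _)) cW.
split=> [_ [[[U U1] V1] /= [[[gU WU] WU1] VV1] <-]|p N].
  rewrite openE => _ [q [/= [q1 q1'] q2] <-].
  rewrite /interior (@nbhs_twisted (g U)); last exact: gP.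
  rewrite /= unchartK; exists (U `&` U1, V1) => /=; last first.
    by move=> r Ur; exists r.
  split; apply: open_nbhs_nbhs; split=> //; last exact: oV.
  by apply: openI; exact: oW.
have /bW[U [WU Up] sU] := cohA p.1.
have gU : good U by exists p.1.
rewrite (@nbhs_twisted (g U)); last exact: gP.
move=> [[N1 N2] /= [/bW[U1 [WU1 U1p] sU1] /bV[V1 [VV1 V1p] sV1]] sN].
exists (base ((U, U1), V1)).
  split; first by exists ((U, U1), V1).
  by exists (chart (g U) p) => //; rewrite chartK.
by move=> _ [q [[_ q1] q2] <-]; apply: sN; split; [exact: sU1|exact: sV1].
Qed.

End Topology.
End TwistedProduct.

Definition in_set_type (X : Type) (A : set X) x (Ax : A x) : set_type A :=
  exist (fun y => y \in A) x (mem_set Ax).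

Lemma nbhs_set_type_image (X : topologicalType) (A : set X) (x : set_type A) N :
  open A -> nbhs x N -> nbhs (set_val x) (set_val @` N).
Proof.
move=> oA /nbhs_set_type[M Mx sN].
have Ax : nbhs (set_val x) A.
  by apply: open_nbhs_nbhs; split=> //; exact: set_valP.
apply: filterS (filterI Mx Ax) => y [My Ay].
by exists (in_set_type Ay) => //; exact: sN.
Qed.

Lemma continuous_at_set_val (X Y : topologicalType) (A : set X)
    (x : set_type A) (f : X -> Y) : open A ->
  {for x, continuous (fun y : set_type A => f (set_val y))} ->
  {for set_val x, continuous f}.
Proof.
move=> oA cf N /cf /(nbhs_set_type_image oA).
by apply: (@filterS _ (nbhs (set_val x))) => _ [y Ny <-].
Qed.

(** * Open, continuous, locally injective maps *)

Section OpenLocallyInjective.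
Variables (X Y : topologicalType) (f : X -> Y).
Hypothesis cf : continuous f.
Hypothesis f_open : forall x N, nbhs x N -> nbhs (f x) (f @` N).
Hypothesis f_inj : forall x : X, exists2 U : set X,
  nbhs x U & forall y z, U y -> U z -> f y = f z -> y = z.

Let open_image A : open A -> open (f @` A).
Proof.
rewrite !openE => oA _ [x Ax <-]; exact/f_open/oA.
Qed.

Lemma local_homeomorphism_of_open : local_homeomorphism f.
Proof.
move=> x; have [U Ux injU] := f_inj x.
exists U°; split.
- exact: open_interior.
- exact: Ux.
- exact/open_image/open_interior.
split.
- move=> y; apply: (continuous_comp (f := set_val) (g := f)); last exact: cf.
  exact: initial_continuous.
- move=> y z /injU e; apply: val_inj; apply: e; apply: interior_subset;
    exact: set_valP.
- apply/seteqP; split=> [_ [y _ <-]|_ [y Uy <-]].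
    by exists (set_val y) => //; exact: set_valP.
  by exists (in_set_type Uy).
move=> A oA; exists ((fun u => f (set_val u)) @` A); last first.
  apply/seteqP; split=> [_ [u Au <-]|y []//].
  by split; [exists u|exists (set_val u) => //; exact: set_valP].
rewrite -(image_comp (set_val : set_type U° -> X) f); apply: open_image.
rewrite openE => _ [u Au <-]; apply: nbhs_set_type_image.
  exact: open_interior.
by move: oA; rewrite openE; exact.
Qed.

(** A compact [K] inside the image of an injectivity neighbourhood is lifted. A filter on the lift
    is pushed into [K]; openness and injectivity then bring its cluster point back. *)
Lemma locally_compact_of_open (R : realType) : hausdorff_space X ->
  hausdorff_space Y -> locally_compact [set: Y] -> locally_compact [set: X].
Proof.
move=> hX hY lcY x _; have [U Ux injU] := f_inj x.
have fUx := f_open (nbhs_interior Ux).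
have [K [Kx cK _ sK]] := locally_compact_nbhs R hY lcY fUx.
exists (U° `&` f @^-1` K).
  rewrite withinET; apply: filterI; first exact: nbhs_interior.
  exact: cf.
suff cC : compact (U° `&` f @^-1` K) by split=> //; exact: compact_closed.
move=> F FF FC; have FK : (f @ F) K by apply: (@filterS _ F _ _ _ _ FC) => y [].
have [p [Kp clp]] := cK _ _ FK; have [h Uh hp] := sK _ Kp.
exists h; split=> [|P N FP Nh]; first by split=> //=; rewrite hp.
have FPC : (f @ F) (f @` (P `&` (U° `&` f @^-1` K))).
  by apply: (@filterS _ F _ _ _ _ (filterI FP FC)) => y Py; exists y.
have NU : nbhs p (f @` (N `&` U°)).
  by rewrite -hp; apply: f_open; apply: filterI => //; exact: nbhs_interior.
have [_ [[y [Py [Uy _]] <-] [z [Nz Uz] yz]]] := clp _ _ FPC NU.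
have zy : z = y by apply: injU yz; exact: interior_subset.
by exists y; split=> //; rewrite -zy.
Qed.

End OpenLocallyInjective.

(** * Iterates of a partial local homeomorphism *)

Section Iterates.
Variables (T : topologicalType) (D : set T) (sigma : T -> T).
Hypothesis plh : partial_local_homeomorphism D sigma.

Let oD : open D. Proof. by case: plh. Qed.

Lemma sigma_continuous x : D x -> {for x, continuous sigma}.
Proof.
move=> Dx; have [_ _ /(_ (in_set_type Dx))[U [oU Ux _ [cf _ _ _]]]] := plh.
apply: (@continuous_at_set_val _ _ _ (in_set_type Dx)) => //.
exact: (@continuous_at_set_val _ _ U (in_set_type Ux)
  (fun y : set_type D => sigma (set_val y)) oU (cf _)).
Qed.

Lemma sigma_open x V : D x -> nbhs x V -> nbhs (sigma x) (sigma @` V).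
Proof.
move=> Dx Vx.
have [_ _ /(_ (in_set_type Dx))[U [oU Ux oim [cf _ _ of_]]]] := plh.
have cu : continuous (fun u : set_type U => set_val (set_val u) : T).
  move=> u; apply: (continuous_comp (f := set_val) (g := set_val));
    exact: initial_continuous.
have [|W oW] := of_ ((fun u : set_type U => set_val (set_val u) : T) @^-1` V°).
  by apply: open_comp => [u _|]; [exact: cu|exact: open_interior].
move=> eW; have : nbhs (sigma x) (W `&` [set sigma (set_val t) | t in U]).
  apply: open_nbhs_nbhs; split; first exact: openI.
  by rewrite -eW; exists (in_set_type Ux) => //; exact: Vx.
rewrite -eW; apply: filterS => _ [u Vu <-].
by exists (set_val (set_val u)) => //; exact: interior_subset.
Qed.

Lemma sigma_locally_injective x : D x -> exists2 U : set T, nbhs x U &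
  forall y z, U y -> U z -> sigma y = sigma z -> y = z.
Proof.
move=> Dx; have [_ _ /(_ (in_set_type Dx))[U [oU Ux _ [_ injf _ _]]]] := plh.
exists (set_val @` U).
  rewrite -[x]/(set_val (in_set_type Dx)).
  by apply: nbhs_set_type_image => //; exact: open_nbhs_nbhs.
move=> _ _ [y Uy <-] [z Uz <-] e.
have := injf (in_set_type Uy) (in_set_type Uz) e.
by move=> /(congr1 (fun u => set_val (set_val u))).
Qed.

Lemma iter_domS k x :
  iter_dom D sigma k.+1 x -> iter_dom D sigma k x /\ D (iter k sigma x).
Proof.
by rewrite -addn1 => /iter_domD[? d1]; split=> //; have := d1 0%N; exact.
Qed.

Lemma iter_continuous k x : iter_dom D sigma k x ->
  {for x, continuous (iter k sigma)}.
Proof.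
elim: k => [_|k IH /iter_domS[/IH ck Dk]]; first exact: cvg_id.
by apply: (continuous_comp ck); exact: sigma_continuous.
Qed.

Lemma nbhs_iter_dom k x : iter_dom D sigma k x -> nbhs x (iter_dom D sigma k).
Proof.
elim: k => [_|k IH /iter_domS[dk Dk]]; first exact: filterE.
have Dn : nbhs (iter k sigma x) D by exact: open_nbhs_nbhs.
apply: filterS (filterI (IH dk) (iter_continuous dk Dn)) => y [dy Dy].
by rewrite -addn1; apply/iter_domD; split=> // -[].
Qed.

Lemma iter_open k x V : iter_dom D sigma k x -> nbhs x V ->
  nbhs (iter k sigma x) (iter k sigma @` V).
Proof.
elim: k => [_|k IH /iter_domS[dk Dk]] Vx; first by rewrite image_id.
have := sigma_open Dk (IH dk Vx); apply: filterS => _ [_ [y Vy <-] <-].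
by exists y.
Qed.

Lemma iter_locally_injective k x : iter_dom D sigma k x ->
  exists2 U : set T, nbhs x U &
  forall y z, U y -> U z -> iter k sigma y = iter k sigma z -> y = z.
Proof.
elim: k => [_|k IH /iter_domS[dk Dk]].
  by exists setT => //; exact: filterT.
have [U Ux injU] := IH dk; have [V Vx injV] := sigma_locally_injective Dk.
exists (U `&` iter k sigma @^-1` V).
  by apply: filterI => //; exact: iter_continuous.
by move=> y z [Uy Vy] [Uz Vz] e; apply: injU => //; exact: injV.
Qed.

End Iterates.

(** * The Renault-Deaconu groupoid is etale *)

Section RDTopology.
Variables (T : topologicalType) (D : set T) (sigma : T -> T).
Hypothesis plh : partial_local_homeomorphism D sigma.

Local Notation G := (renault_deaconu D sigma).
Implicit Types g h : G.

Definition lags (k l : nat) : set G :=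
  [set g | rd_deg g = k%:Z - l%:Z /\
           rd_rel D sigma k l (rd_left g) (rd_right g)].

Lemma lags_ex g : exists k l, lags k l g.
Proof. by have [k [l ?]] := rd_cond g; exists k, l. Qed.

Lemma lags_inv k l g : lags k l g -> lags l k (ginv g).
Proof. by case=> e r; split; [rewrite /= e opprB|exact: rd_rel_sym]. Qed.

Lemma lags_unit t : lags 0 0 (gunit G t).
Proof. by split. Qed.

Lemma lags_mul k q l g h : rd_right g = rd_left h ->
  lags k q g -> lags q l h -> lags k l (gmul g h).
Proof.
move=> gh [eg [d1 _ e1]] [eh [_ d4 e2]].
rewrite -[gmul g h]/(rd_mul g h) /lags /=; have [-> -> ->] := rd_mulP gh.
by split; [rewrite eg eh; lia|split=> //; rewrite e1 gh e2].
Qed.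

(** One endpoint suffices for the domain condition: after [k] and [l] steps respectively, both
    endpoints follow the same orbit. *)
Lemma lagsDr k l m g : iter_dom D sigma (l + m) (rd_right g) ->
  lags k l g -> lags (k + m) (l + m) g.
Proof. by move=> dm [eg r]; split; [lia|exact: rd_relD]. Qed.

Lemma lagsDl k l m g : iter_dom D sigma (k + m) (rd_left g) ->
  lags k l g -> lags (k + m) (l + m) g.
Proof.
move=> dm [eg r]; split; first by lia.
by apply/rd_rel_sym/rd_relD => //; exact: rd_rel_sym.
Qed.

(** Raising the smaller of the two middle lags to the larger gives a common [q]. Multiplicativity of
    the gauges rests on this, since the two middle products then run over the same points. *)
Lemma lags_composable g h : rd_right g = rd_left h ->
  exists k q l, lags k q g /\ lags q l h.
Proof.
move=> gh; have [k1 [k2 vg]] := lags_ex g; have [l1 [l2 vh]] := lags_ex h.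
have [_ [_ d2 _]] := vg; have [_ [d3 _ _]] := vh.
case: (leqP l1 k2) => [le|/ltnW le].
  exists k1, k2, (l2 + (k2 - l1))%N; split=> //.
  by have := lagsDl (m := (k2 - l1)%N) _ vh; rewrite subnKC // -gh => /(_ d2).
exists (k1 + (l1 - k2))%N, l1, l2; split=> //.
by have := lagsDr (m := (l1 - k2)%N) _ vg; rewrite subnKC // gh => /(_ d3).
Qed.

(** The trace, on arrows with lags [k], [l], of the product neighbourhoods in [T * T]. Unlike the
    subbasic sets of the topology, these need no injectivity of the iterates. *)
Definition lag_filter k l g : set_system G :=
  [set N | exists2 UV, nbhs (rd_left g) UV.1 /\ nbhs (rd_right g) UV.2 &
    forall h, lags k l h -> UV.1 (rd_left h) -> UV.2 (rd_right h) -> N h].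

Lemma lag_filter_filter k l g : Filter (lag_filter k l g).
Proof.
split.
- by exists (setT, setT) => //=; split; exact: filterT.
- move=> P Q [[U V] /= [Ug Vg] sP] [[U' V'] /= [Ug' Vg'] sQ].
  exists (U `&` U', V `&` V') => /=; first by split; exact: filterI.
  by move=> h vh [? ?] [? ?]; split; [exact: sP|exact: sQ].
- move=> P Q sPQ [[U V] /= UVg sP]; exists (U, V) => //= h vh Uh Vh.
  exact/sPQ/sP.
Qed.

Lemma rd_open_open I : rd_open_index D sigma I ->
  open (rd_open I : set G).
Proof.
move=> DI; exists [set rd_open I]; last first.
  by apply/seteqP; split=> [g [_ -> ]//|g gI]; exists (rd_open I).
by move=> _ ->; exact: finI_from1.
Qed.

(** The lags of the subbasic set differ from (k, l) by the same amount on both sides. If they are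
    larger, [sigma] is applied further to the equation of the endpoints; if smaller, the surplus
    iterate is cancelled by its local injectivity. *)
Lemma lag_filter_rd_open k l g I : lags k l g ->
  rd_open_index D sigma I -> rd_open I g -> lag_filter k l g (rd_open I).
Proof.
case: I => -[U k'] [V l'] vg [[/= oU dU iU] [/= oV dV iV]] [/= eg Ug Vg e].
have [eg' [dk dl ekl]] := vg.
have Un : nbhs (rd_left g) U by exact: open_nbhs_nbhs.
have Vn : nbhs (rd_right g) V by exact: open_nbhs_nbhs.
case: (leqP k k') => [le|/ltnW le].
  exists (U, V) => //= h [eh [_ _ ehkl]] Uh Vh.
  split=> //=; first by rewrite eh -eg' eg.
  have [m [-> ->]] : exists m, k' = (m + k)%N /\ l' = (m + l)%N.
    by exists (k' - k)%N; lia.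
  by rewrite !iterD ehkl.
have [m ek el] : exists2 m, k = (k' + m)%N & l = (l' + m)%N.
  by exists (k - k')%N; lia.
subst k l; move: dk dl => /iter_domD[dk dm] /iter_domD[dl _].
have [Y Yn injY] := iter_locally_injective plh dm.
exists (U `&` iter k' sigma @^-1` Y, V `&` iter l' sigma @^-1` Y) => /=.
  split; apply: filterI => //; apply: (iter_continuous plh) => //.
  by rewrite -e.
move=> h [eh [_ _ ehkl]] [Uh Yh] [Vh Yh'].
split=> //=; first by rewrite eh -eg' eg.
by apply: injY => //; rewrite -!iterD addnC ehkl addnC.
Qed.

Lemma nbhs_lag_filter k l g : lags k l g -> nbhs g = lag_filter k l g.
Proof.
move=> vg; have FF := lag_filter_filter k l g.
apply/seteqP; split=> [N|N [[U V] /= [Ug Vg] sN]].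
  rewrite nbhsE => -[_ [[B sB <-] [C BC Cg]] sUBN].
  apply: filterS sUBN _; apply: (@filterS _ _ _ C); first by move=> h; exists C.
  have /sB[F sF IFeC] := BC; rewrite -IFeC; apply: filter_bigI => I FI.
  apply: lag_filter_rd_open => //; first exact/set_mem/sF.
  by move: Cg; rewrite -IFeC => /(_ _ FI).
have [eg [dk dl ekl]] := vg.
(* Conversely, [U] and [V] are shrunk to where the iterates are defined and injective, which makes
   them index a subbasic set. *)
have [U' U'g injU] := iter_locally_injective plh dk.
have [V' V'g injV] := iter_locally_injective plh dl.
pose U1 := (U `&` (U' `&` iter_dom D sigma k))°.
pose V1 := (V `&` (V' `&` iter_dom D sigma l))°.
pose I := ((U1, k), (V1, l)).
have DI : rd_open_index D sigma I.
  split; split=> /=; try exact: open_interior.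
  - by move=> x /interior_subset[_ []].
  - move=> x y /set_mem/interior_subset[_ [? _]].
    by move=> /set_mem/interior_subset[_ [? _]]; exact: injU.
  - by move=> x /interior_subset[_ []].
  - move=> x y /set_mem/interior_subset[_ [? _]].
    by move=> /set_mem/interior_subset[_ [? _]]; exact: injV.
have gI : rd_open I g.
  split=> //=.
    exact: (filterI Ug (filterI U'g (nbhs_iter_dom plh dk))).
  exact: (filterI Vg (filterI V'g (nbhs_iter_dom plh dl))).
have := open_nbhs_nbhs (conj (rd_open_open DI) gI).
apply: filterS => h [/= eh /interior_subset[Uh [_ ?]]].
move=> /interior_subset[Vh [_ ?]] ekl'; by apply: sN.
Qed.

Lemma nbhs_lags k l g : lags k l g -> \forall h \near g, lags k l h.
Proof.
move=> vg; rewrite /prop_near1/= (nbhs_lag_filter vg).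
by exists (setT, setT) => //=; split; exact: filterT.
Qed.

Lemma rd_left_continuous : continuous (@rd_left T D sigma : G -> T).
Proof.
move=> g N Ng; have [k [l vg]] := lags_ex g.
suff : nbhs g (@rd_left T D sigma @^-1` N) by [].
rewrite (nbhs_lag_filter vg); exists (N, setT) => //=.
by split=> //; exact: filterT.
Qed.

Lemma rd_right_continuous : continuous (@rd_right T D sigma : G -> T).
Proof.
move=> g N Ng; have [k [l vg]] := lags_ex g.
suff : nbhs g (@rd_right T D sigma @^-1` N) by [].
rewrite (nbhs_lag_filter vg); exists (setT, N) => //=.
by split=> //; exact: filterT.
Qed.

Lemma continuous_rd (Z : topologicalType) (f : Z -> G) z k l :
  {for z, continuous (fun y => rd_left (f y))} ->
  {for z, continuous (fun y => rd_right (f y))} ->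
  (\forall y \near z, lags k l (f y)) -> {for z, continuous f}.
Proof.
move=> cl cr fz N; rewrite (nbhs_lag_filter (nbhs_singleton fz)).
move=> [[U V] /= [/cl Uz /cr Vz] sN].
apply: (@filterS _ (nbhs z) _ _ _ _ (@filterI _ (nbhs z) _ _ _ fz
  (@filterI _ (nbhs z) _ _ _ Uz Vz))).
by move=> y [ly [Uy Vy]]; exact: (sN _ ly Uy Vy).
Qed.

(** A range [x] near that of [g] lifts because [iter l sigma] is open: it reaches [iter k sigma x]
    from some [y] near the source, and [y] is the source of the lifted arrow. *)
Lemma rd_left_open g N : nbhs g N -> nbhs (rd_left g) (@rd_left T D sigma @` N).
Proof.
have [k [l vg]] := lags_ex g; rewrite (nbhs_lag_filter vg).
move=> [[U V] /= [Ug Vg] sN]; have [eg [dk dl ekl]] := vg.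
have Vl : nbhs (rd_right g) (V `&` iter_dom D sigma l).
  exact: filterI Vg (nbhs_iter_dom plh dl).
have := iter_open plh dl Vl; rewrite -ekl; set W := (W in nbhs _ W) => Wn.
have Wg : nbhs (rd_left g) (iter k sigma @^-1` W).
  exact: (iter_continuous plh dk Wn).
apply: filterS (filterI Ug (filterI (nbhs_iter_dom plh dk) Wg)).
move=> x [Ux [dx [y [Vy dy] exy]]].
have c : exists k1 k2 : nat,
    rd_deg g = k1%:Z - k2%:Z /\ rd_rel D sigma k1 k2 x y.
  by exists k, l.
by exists (RDArrow c) => //; apply: sN => //; split=> //; exact: eg.
Qed.

(** With the lags fixed the degree is constant, and the source is recovered from [iter k sigma] of
    the range by local injectivity of [iter l sigma]. *)
Lemma rd_left_locally_injective g : exists2 U : set G, nbhs g U &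
  forall h h', U h -> U h' -> rd_left h = rd_left h' -> h = h'.
Proof.
have [k [l vg]] := lags_ex g; have [_ [_ dl _]] := vg.
have [V Vg injV] := iter_locally_injective plh dl.
exists (lags k l `&` @rd_right T D sigma @^-1` V).
  by apply: filterI; [exact: nbhs_lags|exact: rd_right_continuous].
move=> h h' [[eh [_ _ e]] Vh] [[eh' [_ _ e']] Vh'] ll'.
apply: rd_arrow_eq => //; first by rewrite eh eh'.
by apply: injV => //; rewrite -e -e' ll'.
Qed.

Lemma rd_topological_groupoid : topological_groupoid G.
Proof.
split.
- exact: rd_left_continuous.
- exact: rd_right_continuous.
- move=> t; apply: (continuous_rd (k := 0) (l := 0)); try exact: cvg_id.
  by apply: nearW => u; exact: lags_unit.
- move=> g; have [k [l vg]] := lags_ex g.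
  apply: (continuous_rd (k := l) (l := k)).
  + exact: rd_right_continuous.
  + exact: rd_left_continuous.
  + by apply: filterS (nbhs_lags vg) => h; exact: lags_inv.
apply/subspace_sigL_continuousP => gh.
have [k [q [l [vg vh]]]] := lags_composable (set_valP gh).
have cf := @continuous_set_val_fst _ _ (composable G).
have cs := @continuous_set_val_snd _ _ (composable G).
apply: (continuous_rd (k := k) (l := l)).
- have -> : (fun y => rd_left
      (sigL (composable G) (fun xy => gmul xy.1 xy.2) y)) =
      (fun y => rd_left (set_val y).1).
    by apply/funext => y; have [] := rd_mulP (set_valP y).
  by apply: (continuous_comp (cf gh)); exact: rd_left_continuous.
- have -> : (fun y => rd_right
      (sigL (composable G) (fun xy => gmul xy.1 xy.2) y)) =
      (fun y => rd_right (set_val y).2).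
    by apply/funext => y; have [] := rd_mulP (set_valP y).
  by apply: (continuous_comp (cs gh)); exact: rd_right_continuous.
- have h1 := cf gh _ (nbhs_lags vg); have h2 := cs gh _ (nbhs_lags vh).
  apply: (@filterS _ (nbhs gh) _ _ _ _ (@filterI _ (nbhs gh) _ _ _ h1 h2)).
  move=> y [? ?].
  by apply: lags_mul; [exact: (set_valP y)| |]; eassumption.
Qed.

Lemma rd_hausdorff : hausdorff_space T -> hausdorff_space G.
Proof.
move=> hT g h clgh; apply: rd_arrow_eq.
- by apply: (cluster_continuous hT _ _ clgh); exact: rd_left_continuous.
(* The degree is locally constant, so arrows that cluster share it. *)
- have [k [l vg]] := lags_ex g; have [k' [l' vh]] := lags_ex h.
  have [x [[ex _] [ex' _]]] := clgh _ _ (nbhs_lags vg) (nbhs_lags vh).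
  by case: vg vh => -> _ [-> _]; rewrite -ex.
- by apply: (cluster_continuous hT _ _ clgh); exact: rd_right_continuous.
Qed.

Lemma rd_second_countable : @second_countable T -> @second_countable G.
Proof.
move=> [W cW [oW bW]].
pose base (I : (set T * set T) * (nat * nat)) : set G :=
  [set g | [/\ lags I.2.1 I.2.2 g, I.1.1 (rd_left g) & I.1.2 (rd_right g)]].
exists (base @` ((W `*` W) `*` setT)).
  by apply: countable_image; do 2?[apply: countableX => //]; exact: countableP.
split=> [_ [[[U V] [k l]] [[/= WU WV] _] <-]|g N].
  rewrite openE => g [/= vg Ug Vg].
  rewrite /interior (nbhs_lag_filter vg); exists (U, V) => //=.
  by split; apply: open_nbhs_nbhs; split=> //; exact: oW.
have [k [l vg]] := lags_ex g; rewrite (nbhs_lag_filter vg).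
move=> [[U V] /= [/bW[U' [WU Ug] sU] /bW[V' [WV Vg] sV]] sN].
exists (base ((U', V'), (k, l))).
  by split=> //; exists ((U', V'), (k, l)).
by move=> h [/= vh Uh Vh]; apply: sN => //; [exact: sU|exact: sV].
Qed.

Lemma rd_etale (R : realType) : @second_countable T -> hausdorff_space T ->
  locally_compact [set: T] -> etale_groupoid G.
Proof.
move=> scT hT lcT; split; first split.
- exact: rd_topological_groupoid.
- exact: rd_second_countable.
- apply: (locally_compact_of_open rd_left_continuous rd_left_open
    rd_left_locally_injective R) => //; exact: rd_hausdorff.
- exact: rd_hausdorff.
exact: (local_homeomorphism_of_open rd_left_continuous rd_left_open
    rd_left_locally_injective).
Qed.

End RDTopology.

Lemma continuous_near_eq (X Y : topologicalType) (f g : X -> Y) (x : X) :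
  (\forall y \near x, f y = g y) -> {for x, continuous g} ->
  {for x, continuous f}.
Proof.
move=> fg cg N; rewrite (nbhs_singleton fg) => /cg gN.
apply: (@filterS _ (nbhs x) _ _ _ _ (@filterI _ (nbhs x) _ _ _ fg gN)).
by move=> y [/= ->].
Qed.

(** * Gauges of a circle bundle and of the groupoid *)

Section BundleGauge.
Variables (R : realType) (X : topologicalType) (B : circle_space R X).
Hypothesis pB : principal_circle_bundle B.

Lemma cact_free z w (e : B) : cact z e = cact w e -> z = w.
Proof.
have [[act1 actM _] [free _] _ _] := pB => ezw.
have /free : cact (circle_inv w *c z) e = e.
  by rewrite actM ezw -actM circle_mulC circle_mulV act1.
move=> /(congr1 (circle_mul w)) ewz.
have -> : z = w *c (circle_inv w *c z) by circle_field.
by rewrite ewz; circle_field.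
Qed.

(** A trivialization [phi] yields the section phi(-, 1) and, inverted, the fibre coordinate [w].
    Both are made total by arbitrary values away from [U], so that they can be evaluated without
    membership proofs. *)
Lemma bundle_local_section (x : X) :
  exists (U : set X) (s : X -> B) (w : B -> circle R),
  [/\ open U, U x,
      forall y, U y -> bproj (s y) = y /\ {for y, continuous s} &
      forall e, U (bproj e) ->
        e = cact (w e) (s (bproj e)) /\ {for e, continuous w}].
Proof.
have [[act1 actM _] _ cp loc] := pB.
have [U [oU Ux [phi [[cphi iphi rphi ophi] pphi aphi]]]] := loc x.
pose one := circle_one R.
pose s y := if pselect (U y) is left Uy then phi (in_set_type Uy, one)
            else phi (in_set_type Ux, one).
have sE (u : set_type U) : s (set_val u) = phi (u, one).
  rewrite /s; case: pselect => [Uu|[]]; last exact: set_valP.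
  have -> // : in_set_type Uu = u by exact: val_inj.
have /choice[w wP] : forall e : B, exists z, U (bproj e) ->
    exists u, phi (u, z) = e.
  move=> e; have [Ue|nUe] := pselect (U (bproj e)); last by exists one.
  have [[u z] _ <-] : range phi e by rewrite rphi.
  by exists z => _; exists u.
exists U, s, w; split=> // [y Uy|e Ue].
  rewrite -[y]/(set_val (in_set_type Uy)); split; first by rewrite sE pphi.
  apply: continuous_at_set_val => //.
  have -> : (fun u : set_type U => s (set_val u)) = (fun u => phi (u, one)).
    by apply/funext.
  apply: (continuous_comp (f := fun u => (u, one))); last exact: cphi.
  by apply: continuous_pair; [exact: cvg_id|exact: cst_continuous].
have [u eu] := wP e Ue; split.
  have pu : bproj e = set_val u by rewrite -eu pphi.
  have we : w e *c one = w e by circle_field.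
  by rewrite pu sE -aphi we eu.
(* Continuity of [w] is openness of [phi]: the preimage of an open set under [w], over [U], is the
   [phi]-image of a cylinder. *)
move=> N Ne; have [V oV eV] : exists2 V, open V &
    phi @` (snd @^-1` N°) = V `&` (@bproj R X B @^-1` U).
  apply: ophi; apply: open_comp => [p _|]; first exact: continuous_snd.
  exact: open_interior.
have : nbhs e (V `&` (@bproj R X B @^-1` U)).
  apply: open_nbhs_nbhs; split; first by apply: openI => //; exact: open_comp.
  by rewrite -eV; exists (u, w e) => //; exact: Ne.
rewrite -eV; apply: (@filterS _ (nbhs e)) => _ [[v z] /= Nz <-].
have [v' /iphi [_ ->]] : exists u, phi (u, w (phi (v, z))) = phi (v, z).
  by apply: wP; rewrite pphi; exact: set_valP.
exact: interior_subset.
Qed.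

(* [c] is a set-theoretic section, [s x] a section continuous near [x], [w x]
   the fibre coordinate relative to [s x]; [a x] compares [s x] with [c]. *)
Lemma bundle_gauge : exists (c : X -> B) (s : X -> X -> B)
    (w : X -> B -> circle R) (a : X -> X -> circle R),
  [/\ forall x, bproj (c x) = x,
      forall x, \forall y \near x,
        s x y = cact (a x y) (c y) /\ {for y, continuous (s x)},
      forall x, \forall y \near x, forall e, bproj e = y ->
        e = cact (w x e) (s x y) /\ {for e, continuous (w x)} &
      coherent a].
Proof.
have [[act1 actM _] [free trans] cp _] := pB.
have /choice[q qP] : forall x, exists q : set X * (X -> B) * (B -> circle R),
  [/\ open q.1.1, q.1.1 x,
      forall y, q.1.1 y -> bproj (q.1.2 y) = y /\ {for y, continuous q.1.2} &
      forall e, q.1.1 (bproj e) ->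
        e = cact (q.2 e) (q.1.2 (bproj e)) /\ {for e, continuous q.2}].
  by move=> x; have [U [s [w h]]] := bundle_local_section x; exists (U, s, w).
pose U x := (q x).1.1; pose s x := (q x).1.2; pose w x := (q x).2.
have nU x y : U x y -> nbhs y (U x).
  by move=> Uy; apply: open_nbhs_nbhs; split=> //; have [] := qP x.
have Ux x : U x x by have [] := qP x.
have sP x y : U x y -> bproj (s x y) = y /\ {for y, continuous (s x)}.
  by have [_ _ h _] := qP x; exact: h.
have wP x e : U x (bproj e) ->
    e = cact (w x e) (s x (bproj e)) /\ {for e, continuous (w x)}.
  by have [_ _ _ h] := qP x; exact: h.
(* The diagonal choice: each point takes its value from its own local section, with no continuity
   between points. *)
pose c x := s x x; have cP x : bproj (c x) = x by have [] := sP _ _ (Ux x).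
have /choice[a aP] : forall x, exists a : X -> circle R,
    forall y, U x y -> s x y = cact (a y) (c y).
  move=> x; suff /choice[a] : forall y, exists z, U x y -> s x y = cact z (c y).
    by exists a.
  move=> y.
  have [Uy|nUy] := pselect (U x y); last by exists (circle_one R).
  have [z ez] : exists z, s x y = cact z (c y).
    by apply: trans; rewrite cP; have [] := sP _ _ Uy.
  by exists z.
exists c, s, w, a; split=> //.
- move=> x; apply: filterS (nU _ _ (Ux x)) => y Uy.
  by split; [exact: aP|have [] := sP _ _ Uy].
- move=> x; apply: filterS (nU _ _ (Ux x)) => y Uy e ey.
  by rewrite -ey; apply: wP; rewrite ey.
- move=> x; apply: filterS (nU _ _ (Ux x)) => y Uy.
  (* The arbitrary section cancels in a_x / a_y, which is the transition function from [s y] to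
     [s x] and hence continuous. *)
  apply: (@continuous_near_eq _ _ _ (w y \o s x)).
    apply: filterS (filterI (nU _ _ Uy) (nU _ _ (Ux y))) => z [Uxz Uyz] /=.
    have [pz _] := sP _ _ Uxz; have [] := wP y (s x z); first by rewrite pz.
    set v := w y (s x z); rewrite pz aP // (aP y) // -actM => /cact_free -> _.
    by circle_field.
  have [py sc] := sP _ _ Uy.
  by apply: (continuous_comp sc); have [|//] := wP y (s x y); rewrite py.
Qed.

End BundleGauge.

Section ExtendGauge.
Variables (R : realType) (T : topologicalType) (D : set T).
Variable a : set_type D -> set_type D -> circle R.

(** Extended by 1 to all of [T], so that it can be evaluated along orbits of the total function
    [sigma]. *)
Definition extend_gauge (t x : T) : circle R :=
  if pselect (D t) is left Dt then
    if pselect (D x) is left Dx then a (in_set_type Dt) (in_set_type Dx)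
    else circle_one R
  else circle_one R.

Lemma extend_gaugeE (t x : set_type D) :
  extend_gauge (set_val t) (set_val x) = a t x.
Proof.
rewrite /extend_gauge; case: pselect => [Dt|[]]; last exact: set_valP.
case: pselect => [Dx|[]]; last exact: set_valP.
by congr (a _ _); apply: val_inj.
Qed.

Lemma extend_gauge_coherent : open D -> coherent a -> forall t, D t ->
  \forall x \near t, gauge_equiv x (extend_gauge t) (extend_gauge x).
Proof.
move=> oD coha t Dt.
have := nbhs_set_type_image oD (coha (in_set_type Dt)).
apply: filterS => _ [x ax <-]; apply: (continuous_at_set_val oD).
rewrite -[t]/(set_val (in_set_type Dt)).
suff -> : (fun y : set_type D =>
    extend_gauge (set_val (in_set_type Dt)) (set_val y) /c
    extend_gauge (set_val x) (set_val y)) =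
    (fun y => a (in_set_type Dt) y /c a x y).
  exact: ax.
by apply/funext => y; rewrite !extend_gaugeE.
Qed.

End ExtendGauge.

Section GroupoidGauge.
Variables (R : realType) (T : topologicalType) (D : set T) (sigma : T -> T).
Hypothesis plh : partial_local_homeomorphism D sigma.
Variable alpha : T -> T -> circle R.
Hypothesis alpha_coherent : forall t, D t ->
  \forall x \near t, gauge_equiv x (alpha t) (alpha x).

Local Notation G := (renault_deaconu D sigma).
Implicit Types g h : G.

Fixpoint iter_gauge (k : nat) (t x : T) : circle R :=
  if k is k'.+1 then
    iter_gauge k' t x *c alpha (iter k' sigma t) (iter k' sigma x)
  else circle_one R.

Lemma iter_gaugeD k m t x : iter_gauge (k + m) t x =
  iter_gauge k t x *c iter_gauge m (iter k sigma t) (iter k sigma x).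
Proof.
elim: m => [|m IH]; first by rewrite addn0 /=; circle_field.
rewrite addnS /= IH -!iterD [(m + k)%N]addnC; circle_field.
Qed.

Lemma iter_gauge_coherent k t : iter_dom D sigma k t ->
  \forall x \near t, gauge_equiv x (iter_gauge k t) (iter_gauge k x).
Proof.
elim: k => [_|k IH /iter_domS[dk Dk]].
  by apply: nearW => x; exact: gauge_equiv_refl.
have h := iter_continuous plh dk (alpha_coherent Dk).
apply: (@filterS _ (nbhs t) _ _ _ _ (@filterI _ (nbhs t) _ _ _
  (nbhs_iter_dom plh dk) (@filterI _ (nbhs t) _ _ _ (IH dk) h))).
move=> x [dx [IHx hx]]; apply: gauge_equiv_mul => //.
apply: (gauge_equiv_comp (h := iter k sigma)) hx.
exact: (iter_continuous plh dx).
Qed.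

Definition rd_gauge k l g h : circle R :=
  iter_gauge k (rd_left g) (rd_left h) /c
  iter_gauge l (rd_right g) (rd_right h).

Lemma rd_gauge_coherent k l g : lags k l g ->
  \forall h \near g, gauge_equiv h (rd_gauge k l g) (rd_gauge k l h).
Proof.
move=> [_ [dk dl _]].
have hl := rd_left_continuous plh (iter_gauge_coherent dk).
have hr := rd_right_continuous plh (iter_gauge_coherent dl).
apply: (@filterS _ (nbhs g) _ _ _ _ (@filterI _ (nbhs g) _ _ _ hl hr)).
move=> h [lh rh]; apply: gauge_equiv_mul.
  apply: (gauge_equiv_comp (h := @rd_left T D sigma : G -> T)) lh.
  exact: rd_left_continuous.
apply: gauge_equiv_inv.
apply: (gauge_equiv_comp (h := @rd_right T D sigma : G -> T)) rh.
exact: rd_right_continuous.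
Qed.

(* On arrows with lags [k], [l] the two tails of the products are gauges over
   the same points and cancel. *)
Lemma rd_gauge_shift k l m g : lags k l g ->
  gauge_equiv g (rd_gauge (k + m) (l + m) g) (rd_gauge k l g).
Proof.
move=> vg; apply: gauge_equiv_near; apply: filterS (nbhs_lags plh vg) => h vh.
have [_ [_ _ eg]] := vg; have [_ [_ _ eh]] := vh.
by rewrite /rd_gauge !iter_gaugeD eg eh; circle_field.
Qed.

Lemma rd_gauge_equiv k l k' l' g : lags k l g -> lags k' l' g ->
  gauge_equiv g (rd_gauge k l g) (rd_gauge k' l' g).
Proof.
move=> vg vg'; have [eg _] := vg; have [eg' _] := vg'.
case: (leqP k k') => [le|/ltnW le].
  have [m [-> ->]] : exists m, k' = (k + m)%N /\ l' = (l + m)%N.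
    by exists (k' - k)%N; lia.
  exact/gauge_equiv_sym/rd_gauge_shift.
have [m [-> ->]] : exists m, k = (k' + m)%N /\ l = (l' + m)%N.
  by exists (k - k')%N; lia.
exact: rd_gauge_shift.
Qed.

(** A family of gauges indexed by arrows needs one pair of lags for each; by [rd_gauge_equiv] any
    choice gives the same topology. *)
Definition lag1 g := sval (cid (lags_ex g)).
Definition lag2 g := sval (cid (svalP (cid (lags_ex g)))).

Lemma lag12P g : lags (lag1 g) (lag2 g) g.
Proof. exact: svalP (cid (svalP (cid (lags_ex g)))). Qed.

Definition twist_gauge g : G -> circle R := rd_gauge (lag1 g) (lag2 g) g.

Lemma twist_gauge_equiv k l g : lags k l g ->
  gauge_equiv g (rd_gauge k l g) (twist_gauge g).
Proof. by move=> vg; apply: rd_gauge_equiv => //; exact: lag12P. Qed.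

(** A nearby arrow admits the lags of [g] but may have been assigned others, so coherence at fixed
    lags is followed by a change of lags. *)
Lemma twist_gauge_coherent : coherent twist_gauge.
Proof.
move=> g; have vg := lag12P g.
apply: filterS (filterI (nbhs_lags plh vg) (rd_gauge_coherent vg)) => h [vh gh].
exact: gauge_equiv_trans gh (twist_gauge_equiv vh).
Qed.

End GroupoidGauge.

Lemma homeomorphism_onto_cancel (X Y : topologicalType)
    (f : X -> Y) (g : Y -> X) :
  continuous f -> continuous g -> cancel f g -> cancel g f ->
  homeomorphism_onto f setT.
Proof.
move=> cf cg fK gK; split=> //; first exact: can_inj fK.
  by apply/seteqP; split=> // y _; exists (g y).
move=> A oA; exists (g @^-1` A); first by apply: open_comp.
rewrite setIT; apply/seteqP; split=> [_ [x Ax <-]|y Ay]; first by rewrite /= fK.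
by exists (g y).
Qed.

(** * The twist defined by a multiplicative family of gauges *)

Section TwistedGroupoid.
Variables (R : realType) (U : topologicalType) (G : groupoid U).
Variables (A : G -> G -> circle R) (cohA : coherent A).

Local Notation L := (twisted cohA).

Definition twisted_groupoid : groupoid U.
Proof.
apply: (@Groupoid U L (fun x => grng x.1) (fun x => gsrc x.1)
  (fun u => (gunit G u, circle_one R)) (fun x => (ginv x.1, circle_inv x.2))
  (fun x y => (gmul x.1 y.1, x.2 *c y.2))) => /=.
- exact: grng_unit.
- exact: gsrc_unit.
- by move=> x; exact: grng_inv.
- by move=> x; exact: gsrc_inv.
- by move=> x y; exact: grng_mul.
- by move=> x y; exact: gsrc_mul.
- by move=> x y z xy yz; rewrite gmulA // circle_mulA.
- by case=> x z; rewrite gmul1g circle_mul1.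
- by case=> x z; rewrite gmulg1 circle_mulC circle_mul1.
- by case=> x z; rewrite gmulgV circle_mulV.
- by case=> x z; rewrite gmulVg circle_mulC circle_mulV.
Defined.

Hypothesis etG : etale_groupoid G.
(** Multiplicativity up to continuous factors. Since the algebra ignores the gauges, these three
    conditions are what relates it to the twisted topology: they give continuity of unit, inverse
    and product. *)
Hypothesis A_unit : forall u,
  gauge_equiv (gunit G u) (fun=> circle_one R) (A (gunit G u)).
Hypothesis A_inv : forall g,
  gauge_equiv g (fun h => circle_inv (A g h)) (fun h => A (ginv g) (ginv h)).
Hypothesis A_mul : forall gh : set_type (composable G),
  gauge_equiv gh
    (fun xy =>
       A (set_val gh).1 (set_val xy).1 *c A (set_val gh).2 (set_val xy).2)
    (fun xy => A (gmul (set_val gh).1 (set_val gh).2)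
                 (gmul (set_val xy).1 (set_val xy).2)).

Let tG : topological_groupoid G. Proof. by case: etG => -[]. Qed.

Let continuous_p : continuous (fst : L -> G).
Proof. exact: continuous_twisted_fst. Qed.

Lemma twisted_topological_groupoid : topological_groupoid twisted_groupoid.
Proof.
have [cr cs cu ci cm] := tG; split.
- move=> x; exact: (continuous_comp (@continuous_p x) (g := @grng _ G)
    (cr x.1)).
- move=> x; exact: (continuous_comp (@continuous_p x) (g := @gsrc _ G)
    (cs x.1)).
- move=> u; apply: (@continuous_twisted_pair _ _ _ cohA _ (gunit G)
      (fun=> circle_one R) (fun=> circle_one R)).
  + exact: A_unit.
  + exact: cu.
  + exact: cst_continuous.
- move=> x; apply: (@continuous_twisted_pair _ _ _ cohA _
      (fun y : L => ginv y.1) (fun y : L => circle_inv y.2) (A (ginv x.1))).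
  + exact: gauge_equiv_refl.
  + exact: (continuous_comp (@continuous_p x) (g := @ginv _ G) (ci _)).
  + suff -> : (fun y : L => circle_inv y.2 /c A (ginv x.1) (ginv y.1)) =
        (fun y : L => circle_inv (y.2 /c A x.1 y.1) *c
           (circle_inv (A x.1 y.1) /c A (ginv x.1) (ginv y.1))).
      apply: continuous_circle_mul; last first.
        exact: (gauge_equiv_comp (@continuous_p x) (@A_inv x.1)).
      apply: continuous_circle_inv; apply: continuous_twisted_snd.
      exact: gauge_equiv_refl.
    by apply/funext => y; circle_field.
apply/subspace_sigL_continuousP => xy.
pose Z := set_type (composable twisted_groupoid).
pose f (v : Z) : L := (set_val v).1; pose g (v : Z) : L := (set_val v).2.
have cf : continuous f by exact: continuous_set_val_fst.
have cg : continuous g by exact: continuous_set_val_snd.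
have fg (v : Z) : composable G ((f v).1, (g v).1) by exact: (set_valP v).
pose q (v : Z) : set_type (composable G) := in_set_type (fg v).
have cq : continuous q.
  move=> v; apply: continuous_set_type; apply: continuous_pair.
    exact: (continuous_comp (cf v) (@continuous_p _)).
  exact: (continuous_comp (cg v) (@continuous_p _)).
have {}cm : {for q xy, continuous
    (sigL (composable G) (fun z : G * G => gmul z.1 z.2))}.
  by move/subspace_sigL_continuousP : cm; exact.
have cqm : {for xy, continuous (fun v : Z => gmul (f v).1 (g v).1)}.
  exact: (continuous_comp (cq xy) cm).
pose x := f xy; pose y := g xy.
suff : {for xy, continuous
    (fun v : Z => (gmul (f v).1 (g v).1, (f v).2 *c (g v).2) : L)} by [].
apply: (continuous_twisted_pair (gauge_equiv_refl _ (A (gmul x.1 y.1))) cqm).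
(* The chart coordinate of a product is the product of those of the factors times [m], the defect of
   multiplicativity, continuous by [A_mul]. *)
pose a v := (f v).2 /c A x.1 (f v).1; pose b v := (g v).2 /c A y.1 (g v).1.
pose m v := A x.1 (f v).1 *c A y.1 (g v).1 /c
  A (gmul x.1 y.1) (gmul (f v).1 (g v).1).
suff -> : (fun v : Z => (f v).2 *c (g v).2 /c
    A (gmul x.1 y.1) (gmul (f v).1 (g v).1)) = (fun v => a v *c b v *c m v).
  apply: continuous_circle_mul; last first.
    exact: (gauge_equiv_comp (cq xy) (@A_mul (q xy))).
  apply: continuous_circle_mul.
    apply: (continuous_comp (cf xy) (g := fun z : L => z.2 /c A x.1 z.1)).
    by apply: continuous_twisted_snd; exact: gauge_equiv_refl.
  apply: (continuous_comp (cg xy) (g := fun z : L => z.2 /c A y.1 z.1)).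
  by apply: continuous_twisted_snd; exact: gauge_equiv_refl.
by apply/funext => v; rewrite /a /b /m; circle_field.
Qed.

Lemma twisted_locally_compact_groupoid :
  locally_compact_groupoid twisted_groupoid.
Proof.
have [[_ sc lc hG] _] := etG; split.
- exact: twisted_topological_groupoid.
- exact: twisted_second_countable.
- exact: twisted_locally_compact.
- exact: twisted_hausdorff.
Qed.

Definition twisted_inj (zu : circle_groupoid R U) : twisted_groupoid :=
  (gunit G zu.2, zu.1).

Lemma twisted_inj_hom : groupoid_hom twisted_inj.
Proof.
split=> [[z u]|[z u]|u|[z u] [w v] /= uv]; rewrite /= ?grng_unit ?gsrc_unit //.
rewrite /twisted_inj /=; congr pair.
by rewrite -uv -[X in gmul _ (gunit _ X)](gsrc_unit G) gmulg1.
Qed.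

Lemma twisted_inj_homeo : homeomorphism_onto twisted_inj
  ((fst : twisted_groupoid -> G) @^-1` unit_space G).
Proof.
have [cr cs cu ci cm] := tG; split.
- move=> [z u]; apply: (@continuous_twisted_pair _ _ _ cohA _
      (fun y : circle R * U => gunit G y.2) fst (fun=> circle_one R)).
  + exact: A_unit.
  + apply: (continuous_comp (f := snd) (g := gunit G)); last exact: cu.
    exact: continuous_snd.
  + suff -> : (fun y : circle R * U => y.1 /c circle_one R) = fst.
      exact: continuous_fst.
    by apply/funext => y; circle_field.
- move=> [z u] [w v] [/(congr1 (@grng _ G)) + ->].
  by rewrite !grng_unit => ->.
- apply/seteqP; split=> [_ [[z u] _ <-]|[g z] /= [u _ <-]]; first by exists u.
  by exists (z, u).
(* The set before taking the interior is the largest one whose part over the units lies in the image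
   of [O]. Image points are interior because the left inverse, read in the trivial chart allowed by
   [A_unit], is defined on all of [L] and continuous at them. *)
move=> O oO; exists [set y : L | unit_space G y.1 -> (twisted_inj @` O) y]°.
  exact: open_interior.
apply/seteqP; split=> [_ [[z u] Ozu <-]|y [/interior_subset Oy /Oy //]].
split; last by exists u.
have cpsi : {for twisted_inj (z, u),
    continuous (fun y : L => (y.2 /c circle_one R, gsrc y.1))}.
  apply: continuous_pair; last first.
    exact: (continuous_comp (@continuous_p (twisted_inj (z, u)))
      (g := @gsrc _ G) (cs (gunit G u))).
  exact: (continuous_twisted_snd (cohA := cohA) (p := twisted_inj (z, u))
    (@A_unit u)).
pose p := twisted_inj (z, u).
have On : nbhs (p.2 /c circle_one R, gsrc p.1) O.
  apply: open_nbhs_nbhs; split=> //=; rewrite gsrc_unit.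
  by have -> : z /c circle_one R = z by circle_field.
apply: (@filterS _ (nbhs p) _ _ _ _ (cpsi _ On)) => -[h w] /= Ohw.
move=> [v _ ehv]; exists (w, v); last by rewrite /twisted_inj /= ehv.
move: Ohw; rewrite -ehv gsrc_unit.
by have -> : w /c circle_one R = w by circle_field.
Qed.

(** The gauge [A g] is itself a section: its coordinate in its own chart is constantly 1. *)
Lemma twisted_sections (g : G) : exists V : set G, [/\ open V, V g &
  exists2 s : set_type V -> twisted_groupoid,
    continuous s & forall v, (s v).1 = set_val v].
Proof.
exists [set h | gauge_equiv h (A g) (A h)]°; split.
- exact: open_interior.
- exact: cohA.
exists (fun v => (set_val v, A g (set_val v))) => // v.
apply: (@continuous_twisted_pair _ _ _ cohA _ set_val
  (fun v => A g (set_val v)) (A g)).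
- by have /interior_subset := set_valP v.
- exact: initial_continuous.
- suff -> : (fun y : set_type [set h | gauge_equiv h (A g) (A h)]° =>
      A g (set_val y) /c A g (set_val y)) = (fun=> circle_one R).
    exact: cst_continuous.
  by apply/funext => y; circle_field.
Qed.

Lemma twisted_central (z : circle R) (x : twisted_groupoid) :
  gmul (gmul x (twisted_inj (z, gsrc x))) (ginv x) = twisted_inj (z, grng x).
Proof.
case: x => g w; rewrite /twisted_inj /=; congr pair; last by circle_field.
by rewrite gmulg1 gmulgV.
Qed.

Definition gauge_twist : topological_twist R G.
Proof.
apply: (@TopologicalTwist R U G twisted_groupoid twisted_inj fst) => //.
- exact: twisted_locally_compact_groupoid.
- exact: twisted_inj_hom.
- exact: twisted_inj_homeo.
- exact: twisted_fst_open.
- by apply/seteqP; split=> // g _; exists (g, circle_one R).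
- exact: twisted_sections.
- exact: twisted_central.
Defined.

End TwistedGroupoid.

(** * Multiplicativity of the gauges on the Renault-Deaconu groupoid *)

Section GroupoidGaugeCocycle.
Variables (R : realType) (T : topologicalType) (D : set T) (sigma : T -> T).
Hypothesis plh : partial_local_homeomorphism D sigma.
Variable alpha : T -> T -> circle R.
Hypothesis alpha_coherent : forall t, D t ->
  \forall x \near t, gauge_equiv x (alpha t) (alpha x).

Local Notation G := (renault_deaconu D sigma).
Local Notation A := (@twist_gauge R T D sigma alpha).

Let gauge_of_lags k l (g : G) : lags k l g ->
  gauge_equiv g (rd_gauge alpha k l g) (A g).
Proof. exact: twist_gauge_equiv. Qed.

Lemma twist_gauge_unit (t : T) :
  gauge_equiv (gunit G t) (fun=> circle_one R) (A (gunit G t)).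
Proof.
apply: (gauge_equiv_trans _ (gauge_of_lags (lags_unit D sigma t))).
by apply: gauge_equiv_eq => h; rewrite /rd_gauge /=; circle_field.
Qed.

Lemma twist_gauge_inv (g : G) :
  gauge_equiv g (fun h => circle_inv (A g h)) (fun h => A (ginv g) (ginv h)).
Proof.
have [k [l vg]] := lags_ex g; have [_ _ _ ci _] := rd_topological_groupoid plh.
have e1 := gauge_equiv_comp (ci g) (gauge_of_lags (lags_inv vg)).
have e2 := gauge_equiv_inv (gauge_equiv_sym (gauge_of_lags vg)).
apply: (gauge_equiv_trans e2); apply: gauge_equiv_trans e1.
by apply: gauge_equiv_eq => h; rewrite /rd_gauge /=; circle_field.
Qed.

(** With lags (k, q) and (q, l), the product of length [q] at the source of the first arrow cancels
    the one at the range of the second, leaving the gauge for (k, l). *)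
Lemma twist_gauge_mul (gh : set_type (composable G)) : gauge_equiv gh
  (fun xy => A (set_val gh).1 (set_val xy).1 *c A (set_val gh).2 (set_val xy).2)
  (fun xy => A (gmul (set_val gh).1 (set_val gh).2)
               (gmul (set_val xy).1 (set_val xy).2)).
Proof.
have [_ _ _ _ /subspace_sigL_continuousP cm] := rd_topological_groupoid plh.
have cf := @continuous_set_val_fst _ _ (composable G).
have cs := @continuous_set_val_snd _ _ (composable G).
have c := set_valP gh.
have [k [q [l [vg vh]]]] := lags_composable c.
have e3 := gauge_equiv_comp (cm gh)
  (gauge_of_lags (lags_mul c vg vh)).
have e1 := gauge_equiv_comp (cf gh) (gauge_of_lags vg).
have e2 := gauge_equiv_comp (cs gh) (gauge_of_lags vh).
apply: (gauge_equiv_trans (gauge_equiv_sym (gauge_equiv_mul e1 e2))).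
apply: gauge_equiv_trans e3.
apply: gauge_equiv_eq => xy.
have cxy := set_valP xy.
have [l1 _ r1] := rd_mulP c; have [l2 _ r2] := rd_mulP cxy.
rewrite /rd_gauge /sigL /= l1 r1 l2 r2 [rd_right _](c : _ = rd_left _).
rewrite [rd_right (set_val xy).1](cxy : _ = rd_left _); circle_field.
Qed.

Definition rd_twist (et : etale_groupoid G) : topological_twist R G :=
  gauge_twist (twist_gauge_coherent plh alpha_coherent) et
    twist_gauge_unit twist_gauge_inv twist_gauge_mul.

End GroupoidGaugeCocycle.

(** * The pullback along the embedding of the domain *)

Lemma rd_embed_continuous (T : topologicalType) (D : set T) (sigma : T -> T) :
  partial_local_homeomorphism D sigma -> continuous (@rd_embed T D sigma).
Proof.
move=> plh t; apply: (continuous_rd plh (k := 1) (l := 0)).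
- exact: initial_continuous.
- apply: (continuous_comp (f := set_val) (g := sigma)).
    exact: initial_continuous.
  by apply: (sigma_continuous plh); exact: set_valP.
- apply: (@filterE _ (nbhs t)) => u; split=> //; split=> //.
  by case=> // _; exact: set_valP.
Qed.

Lemma lags_rd_embed (T : topologicalType) (D : set T) (sigma : T -> T)
    (t : set_type D) : lags 1 0 (rd_embed sigma t).
Proof. by split=> //; split=> // -[] // _; exact: set_valP. Qed.

Theorem theorem6p6 (R : realType) (T : topologicalType) (D : set T)
    (sigma : T -> T) (B : circle_space R (set_type D)) :
  @second_countable T ->
  locally_compact [set: T]%classic ->
  hausdorff_space T ->
  partial_local_homeomorphism D sigma ->
  principal_circle_bundle B ->
  @second_countable B ->
  exists L : topological_twist R (renault_deaconu D sigma),
    circle_space_iso (pullback (@rd_embed T D sigma) (twist_bundle L)) B.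
Proof.
move=> scT lcT hT plh pB _; have [oD _ _] := plh.
have [c [s [w [a [cP sP wP coha]]]]] := bundle_gauge pB.
have [[act1 actM cact_cont] [_ trans] cproj _] := pB.
pose et := rd_etale plh R scT hT lcT.
have alphac := extend_gauge_coherent oD coha.
exists (rd_twist plh alphac et).
set L := twist_bundle _.
pose A := @twist_gauge R T D sigma (extend_gauge a).
(* The gauge of [rd_embed sigma t] for the lags (1, 0); along the embedding it reduces to the bundle
   gauge [a t]. *)
pose E (t : set_type D) := rd_gauge (extend_gauge a) 1 0 (rd_embed sigma t).
have EA (t : set_type D) :
    gauge_equiv (rd_embed sigma t) (E t) (A (rd_embed sigma t)).
  exact/twist_gauge_equiv/lags_rd_embed.
have Ea (t u : set_type D) : E t (rd_embed sigma u) = a t u.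
  by rewrite /E /rd_gauge /= extend_gaugeE; circle_field.
pose Lambda := twisted (twist_gauge_coherent plh alphac).
pose P := pullback (@rd_embed T D sigma) L.
have /choice[zeta zetaP] : forall e : B, exists z, e = cact z (c (bproj e)).
  by move=> e; apply: trans; rewrite cP.
pose base (p : P) : set_type D := (set_val p).1.
pose arr (p : P) : Lambda := (set_val p).2.
have arrE (p : P) : (arr p).1 = rd_embed sigma (base p).
  exact: esym (@set_valP _ (@pullback_set R _ _ (@rd_embed T D sigma) L) p).
pose f (p : P) : B := cact (arr p).2 (c (base p)).
pose lift (e : B) : set_type D * L :=
  (bproj e, (rd_embed sigma (bproj e), zeta e)).
have liftP e : pullback_set (@rd_embed T D sigma) (P := L) (lift e) by [].
pose g (e : B) : P := in_set_type (liftP e).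
have cbase : continuous base by exact: continuous_set_val_fst.
have carr : continuous arr by exact: continuous_set_val_snd.
have cf : continuous f.
  move=> p; pose t := base p.
  (* Near [p] the discontinuous [c] is traded for the continuous section [s t]; the factor [a t]
     this costs is the one by which the chart divides. *)
  apply: (@continuous_near_eq _ _ _
    (fun q => cact ((arr q).2 /c E t (arr q).1) (s t (base q)))).
    have := cbase p _ (sP t); apply: (@filterS _ (nbhs p)) => q [sq _].
    by rewrite sq -actM arrE Ea; congr cact; circle_field.
  apply: (continuous_comp
    (f := fun q => ((arr q).2 /c E t (arr q).1, s t (base q)))
    (g := fun ze : circle R * B => cact ze.1 ze.2)); last exact: cact_cont.
  apply: continuous_pair.
    apply: (continuous_comp (carr p)
      (g := fun x : Lambda => x.2 /c E t x.1)).
    by apply: continuous_twisted_snd; rewrite arrE; exact: EA.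
  apply: (continuous_comp (cbase p)).
  by have [] := nbhs_singleton (sP t).
have cg : continuous g.
  move=> e; apply: continuous_set_type; apply: continuous_pair.
    exact: cproj.
  pose t := bproj e.
  suff : {for e, continuous (fun e' => (rd_embed sigma (bproj e'), zeta e') :
    Lambda)} by [].
  apply: (continuous_twisted_pair (z := e)
    (f := fun e' => rd_embed sigma (bproj e')) (a := E t)); first exact: EA.
    apply: (continuous_comp (cproj e)); exact: rd_embed_continuous.
  (* Inverse trade: [zeta] is the coordinate relative to [c], so [zeta] divided by [a t] is the
     coordinate [w t] relative to [s t], by freeness of the action. *)
  apply: (@continuous_near_eq _ _ _ (w t)); last first.
    by have [] := nbhs_singleton (wP t) e erefl.
  have es := cproj e _ (sP t); have ew := cproj e _ (wP t).
  apply: (@filterS _ (nbhs e) _ _ _ _ (@filterI _ (nbhs e) _ _ _ es ew)).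
  move=> e' [[se _] /(_ e' erefl)[we _]]; rewrite Ea.
  have /(cact_free pB) -> : cact (zeta e') (c (bproj e')) =
      cact (w t e' *c a t (bproj e')) (c (bproj e')).
    by rewrite -zetaP actM -se.
  by circle_field.
exists f; split.
- apply: (homeomorphism_onto_cancel cf cg) => [p|e]; last first.
    by rewrite /f /= -zetaP.
  apply: val_inj; rewrite /g /= /lift.
  have fp : bproj (f p) = base p by rewrite /f bproj_cact cP.
  rewrite fp [RHS]surjective_pairing -/(base p) -/(arr p).
  rewrite [arr p]surjective_pairing arrE; congr (_, (_, _)).
  apply: (cact_free pB (e := c (base p))).
  by rewrite -{1}fp -zetaP.
- by move=> p; rewrite /f bproj_cact cP.
- by move=> z p; rewrite /f -actM.
Qed.
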